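(* Let $(M,\tau)$ be a tracial $W^*$-probability space and $B\subset M$ a unital $*$-subalgebra. Consider selfadjoint random variables $X_1,\dots,X_n\in M$ with $\Phi^*(X_1,\dots,X_n:B)<\infty$. Let $D\subset B$ be a unital $*$-subalgebra of $B$ with conditional expectation $E:M\to D$ such that $\tau\circ E=\tau$. Assume that $\dim D<\infty$. Then the following statements are equivalent: (i) $\Phi^*(X_1,\dots,X_n:D)=\Phi^*(X_1,\dots,X_n:B)$. (ii) $\{X_1,\dots,X_n\}$ is free from $B$ with amalgamation over $D$.
   Context: A tracial $W^*$-probability space $(M,\tau)$ is a von Neumann algebra $M$ with a faithful normal trace (tracial state) $\tau:M\to\mathbb C$. For subsets $S_1,\dots,S_p\subset M$, $L^2(S_1,\dots,S_p)$ is the closure of the von Neumann subalgebra generated by the $S_i$ in the norm $\|a\|_{L^2}^2=\tau(aa^* )$. Conjugate variables: for a unital $*$-subalgebra $B\subset M$ and selfadjoint $X_1,\dots,X_n\in M$, the conjugate variables $J_i=J_i(X_1,\dots,X_n:B)$ ($i=1,\dots,n$) are the (necessarily unique, if they exist) vectors in $L^2(X_1,\dots,X_n,B)$ such that $$\tau(J_ib_1X_{i_1}b_2\cdots b_mX_{i_m}b_{m+1})=\sum_{r=1}^m\delta_{i i_r}\,\tau(b_1X_{i_1}b_2\cdots X_{i_{r-1}}b_r)\,\tau(b_{r+1}X_{i_{r+1}}\cdots b_mX_{i_m}b_{m+1})$$ for all $m\ge0$, $b_1,\dots,b_{m+1}\in B$, $1\le i_1,\dots,i_m\le n$ (for $m=0$: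 $\tau(J_ib)=0$ for all $b\in B$). The relative free Fisher information is $\Phi^*(X_1,\dots,X_n:B)=\sum_{i=1}^n\|J_i\|_{L^2}^2$ if conjugate variables exist, and $+\infty$ otherwise. A conditional expectation $E:M\to D$ is a unital $D$-bimodule linear map. Freeness with amalgamation over $D$ (with respect to $E$): subalgebras $M_1,M_2\supset D$ are free with amalgamation over $D$ if $E(a_1\cdots a_s)=0$ whenever all $E(a_j)=0$ and the $a_j$ come alternately from $M_1$ and $M_2$; a set $S$ is free from $B$ over $D$ if the algebra generated by $S$ and $D$ is free from $B$ over $D$. *)

(* Defs.v *)
From HB Require Import structures.
From mathcomp Require Import all_boot all_order all_algebra.
From mathcomp Require Import complex.
From mathcomp Require Import all_classical all_reals all_analysis.

Set Implicit Arguments.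
Unset Strict Implicit.
Unset Printing Implicit Defensive.

Import Order.TTheory GRing.Theory Num.Theory.
Import numFieldNormedType.Exports.

Local Open Scope classical_set_scope.
Local Open Scope complex_scope.
Local Open Scope ring_scope.

(* A Hilbert space is a Banach space over R[i] whose norm comes from an inner
   product (linear in the first argument). *)
Record hilbertType (R : realType) := HilbertType {
  hilbert_sort :> completeNormedModType R[i];
  inner : {dot hilbert_sort for (@Num.conj R[i])};
  inner_norm : forall x : hilbert_sort, `|x| ^+ 2 = inner x x }.

Section Operators.
Context {R : realType} {H : hilbertType R}.
Implicit Types (T : H -> H) (A : set (H -> H)).

Definition bounded_operator T := linear T /\ continuous T.

Definition commutant A : set (H -> H) :=
  [set T | bounded_operator T /\ forall S, A S -> T \o S = S \o T].

Definition square_summable (xi : nat -> H) :=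
  cvgn (series (fun k => `|xi k| ^+ 2 : R[i]^o)).

(* The functional T |-> \sum_k <T xi_k, eta_k>; such functionals, for square
   summable xi and eta, induce the ultraweak topology on bounded operators. *)
Definition ultraweak_form (xi eta : nat -> H) T : R[i] :=
  limn (series (fun k => inner H (T (xi k)) (eta k) : R[i]^o)).

End Operators.

(* A tracial W*-probability space (M, tau). The von Neumann algebra M is given
   as an algebra together with an identification [rep] of M with a
   self-adjoint unital algebra of bounded operators equal to its bicommutant;
   the axioms of an involution for [star] follow from those of [rep]. *)
Record tracialWType (R : realType) := TracialWType {
  space : hilbertType R;
  carrier :> algType R[i];
  star : carrier -> carrier;
  rep : carrier -> space -> space;
  rep_bounded : forall a, bounded_operator (rep a);
  rep_linear : forall (c : R[i]) a b x,
    rep (c *: a + b) x = c *: rep a x + rep b x;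
  rep1 : forall x, rep 1 x = x;
  repM : forall a b x, rep (a * b) x = rep a (rep b x);
  rep_star : forall a x y,
    inner space (rep a x) y = inner space x (rep (star a) y);
  rep_inj : injective rep;
  rep_bicommutant : commutant (commutant (range rep)) = range rep;
  tau : carrier -> R[i];
  tau_linear : scalar tau;
  tau1 : tau 1 = 1;
  tau_ge0 : forall a, 0 <= tau (a * star a);
  tau_faithful : forall a, tau (a * star a) = 0 -> a = 0;
  tau_trace : forall a b, tau (a * b) = tau (b * a);
  (* normality: tau is continuous (at 0) for the ultraweak topology *)
  tau_normal : forall eps : R, 0 < eps ->
    exists (p : nat) (xi eta : 'I_p -> nat -> space) (delta : R),
      [/\ forall j, square_summable (xi j) /\ square_summable (eta j),
          0 < delta
        & forall a,
            (forall j, `|ultraweak_form (xi j) (eta j) (rep a)| < delta%:C) ->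
            `|tau a| < eps%:C] }.

Arguments star {R t}.
Arguments rep {R t}.
Arguments tau {R t}.

Section FreeFisher.
Context {R : realType} {M : tracialWType R}.
Implicit Types (S A B D N : set M) (a b : M).

Definition unital_subalgebra A := subalg_closed [in A].

Definition unital_star_subalgebra A :=
  unital_subalgebra A /\ forall a, A a -> A (star a).

Definition generated_algebra S : set M := smallest unital_subalgebra S.

Definition vN_subalgebra N :=
  unital_star_subalgebra N /\
  commutant (commutant [set rep a | a in N]) = [set rep a | a in N].

Definition generated_vN S : set M := smallest vN_subalgebra S.

Definition norm2 a : R := Num.sqrt (complex.Re (tau (a * star a))).

(* The vectors of L^2(S), the ||.||_2-completion of the von Neumann algebra
   generated by S, represented by ||.||_2-Cauchy sequences; two sequences
   represent the same vector when the norm of their difference tends to 0. *)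
Record L2 S := L2Vector {
  L2_seq :> nat -> M;
  L2_mem : forall k, generated_vN S (L2_seq k);
  L2_cauchy : forall eps : R, 0 < eps -> exists K : nat,
    forall k l, (K <= k)%N -> (K <= l)%N ->
      norm2 (L2_seq k - L2_seq l) < eps }.

Definition L2_norm S (J : L2 S) : R := limn (fun k => norm2 (J k)).

(* tau (J a) for J a vector and a in M *)
Definition L2_tau S (J : L2 S) a : R[i] := limn (fun k => tau (J k * a) : R[i]^o).

(* b_p X_(i_p) b_(p+1) X_(i_(p+1)) ... b_(q-1) X_(i_(q-1)) b_q *)
Definition word n (X : 'I_n -> M) (b : nat -> M) (i : nat -> 'I_n)
    (p q : nat) : M :=
  (\prod_(p <= k < q) (b k * X (i k))) * b q.

Definition conjugate_variables n (X : 'I_n -> M) B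
    (J : 'I_n -> L2 (range X `|` B)) :=
  forall (i : 'I_n) (m : nat) (b : nat -> M) (s : nat -> 'I_n),
    (forall k, B (b k)) ->
    L2_tau (J i) (word X b s 0 m) =
    \sum_(r < m) (i == s r)%:R *
      (tau (word X b s 0 r) * tau (word X b s r.+1 m)).

(* Relative free Fisher information. Conjugate variables being unique as L^2
   vectors, the value does not depend on the chosen representatives. *)
Definition free_fisher n (X : 'I_n -> M) B : \bar R :=
  if pselect (exists J, @conjugate_variables n X B J) is left exJ
  then (\sum_(i < n) L2_norm (sval (cid exJ) i) ^+ 2)%:E
  else +oo%E.

Definition finite_dimensional D :=
  exists (d : nat) (e : 'I_d -> M), (forall i, D (e i)) /\
    forall a, D a -> exists c : 'I_d -> R[i], a = \sum_i c i *: e i.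

(* Conditional expectation E : M -> D *)
Definition conditional_expectation D (E : M -> M) :=
  [/\ linear E, forall a, D (E a), E 1 = 1
    & forall d1 d2 a, D d1 -> D d2 -> E (d1 * a * d2) = d1 * E a * d2].

(* For M1 and M2 containing the range of E; c selects the algebra the first
   factor belongs to. *)
Definition free_subalgebras (E : M -> M) (M1 M2 : set M) :=
  forall (s : nat) (c : bool) (a : 'I_s.+1 -> M),
    (forall j : 'I_s.+1, (if c (+) odd j then M1 else M2) (a j)) ->
    (forall j, E (a j) = 0) ->
    E (\prod_j a j) = 0.

Definition free_over D (E : M -> M) S B :=
  free_subalgebras E (generated_algebra (S `|` D)) B.

End FreeFisher.

(* Main.v *)
(* Conjugate variables relative to D are the orthogonal projections of those
   relative to B onto L^2(X, D), so (i) says exactly that both families agree.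

   (ii) => (i): alg(X, B) is spanned by D and by alternating products w of
   centered elements of A = alg(X, D) and of B. If w is not in A, freeness makes
   both tau (J_i^D w) and the value of the free difference quotient of w under
   tau (x) tau vanish, hence J^D satisfies the relations defining J^B.

   (i) => (ii): let (e_k, f_k) be dual bases of D for tau, so that
   Omega = sum_k e_k (x) f_k commutes with D, and let delta be the derivation of
   alg(X, B) that vanishes on B and maps x to x Omega - Omega x on X. Then
   (tau (x) tau) (delta w) = tau (Lambda w), where Lambda is
   sum_{i,k} f_k (J_i X_i - X_i J_i) e_k. By (i) Lambda lies in L^2(X, D), while
   it is orthogonal to A since delta is the commutator with Omega there; so
   Lambda = 0. For an alternating product w of even length all but one of the
   terms of (tau (x) tau) (delta w) vanish by induction on the length, leaving
   tau w = 0 up to sign, and odd lengths reduce to shorter ones by traciality. *)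

Require Import Defs.
From HB Require Import structures.
From mathcomp Require Import all_boot all_order all_algebra.
From mathcomp Require Import complex.
From mathcomp Require Import all_classical all_reals all_analysis.
From mathcomp Require Import ring lra.

Set Implicit Arguments.
Unset Strict Implicit.
Unset Printing Implicit Defensive.

Import Order.TTheory GRing.Theory Num.Theory.
Import numFieldNormedType.Exports.

Local Open Scope classical_set_scope.
Local Open Scope complex_scope.
Local Open Scope ring_scope.

(** * Real semi-inner products *)

(** M acts on an arbitrary faithful space, not on the one built from [tau], so two analytic facts
    have to be earned. [Lambda] places [J_i] between elements of M, which requires multiplication to
    be bounded for the 2-norm. The conjugate relations only test the algebra generated by X and B,
    while [L2] is built on its von Neumann closure, which requires 2-norm density. Both come from
    normality, through one inequality that bounds the 2-norm by a vector norm in the Hilbert sum of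
    countably many copies of the space.

    Algebraic relations between X and B may prevent free difference quotients from being maps on M.
    Derivations therefore act on expressions, and the conjugate relations show afterwards that the
    value under tau (x) tau depends on the element alone.

    Finite dimension of D makes [Omega] a finite sum. Since [Omega] commutes with D, the commutator
    with it vanishes on D, which is why it agrees with [delta] on alg(X, D). *)

(* Only real parts of complex inner products are used; complex statements are
   recovered by scaling one argument by 'i. *)
Record semi_inner (R : realType) (V : lmodType R[i]) (g : V -> V -> R) : Prop :=
  SemiInner {
    si_sym : forall x y, g x y = g y x;
    si_add : forall x y z, g (x + y) z = g x z + g y z;
    si_scale : forall r x y, g (r%:C *: x) y = r * g x y;
    si_ge0 : forall x, 0 <= g x x }.

Definition real_subspace (R : realType) (V : lmodType R[i]) (W : set V) :=
  W 0 /\ forall r x y, W x -> W y -> W (x + r%:C *: y).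

Section SemiInner.
Context {R : realType} {V : lmodType R[i]} {g : V -> V -> R}.
Hypothesis gP : semi_inner g.
Implicit Types (x y z : V) (r : R).

Let gC := si_sym gP.
Let gD := si_add gP.
Let gZ := si_scale gP.
Let g0 := si_ge0 gP.

Lemma si_addr x y z : g x (y + z) = g x y + g x z.
Proof. by rewrite gC gD !(gC _ x). Qed.

Lemma si_scaler r x y : g x (r%:C *: y) = r * g x y.
Proof. by rewrite gC gZ gC. Qed.

Lemma si_opp x y : g (- x) y = - g x y.
Proof. by rewrite -scaleN1r -(rmorph1 (real_complex R)) -rmorphN gZ mulN1r. Qed.

Lemma si_oppr x y : g x (- y) = - g x y.
Proof. by rewrite gC si_opp gC. Qed.

Lemma si_0l y : g 0 y = 0.
Proof. by rewrite -(subrr y) gD si_opp subrr. Qed.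

Lemma si_0r y : g y 0 = 0. Proof. by rewrite gC si_0l. Qed.

Lemma si_sumr (I : Type) (s : seq I) (F : I -> V) x :
  g x (\sum_(i <- s) F i) = \sum_(i <- s) g x (F i).
Proof.
by elim: s => [|i s IH]; rewrite ?big_nil ?si_0r// !big_cons si_addr IH.
Qed.

Lemma si_sqrD r x y : g (x + r%:C *: y) (x + r%:C *: y) =
  g x x + 2 * r * g x y + r ^+ 2 * g y y.
Proof. rewrite !gD !si_addr !gZ !si_scaler (gC y x); ring. Qed.

Lemma si_sqrB x y : g (x - y) (x - y) = g x x - 2 * g x y + g y y.
Proof. rewrite !gD !si_addr !si_opp !si_oppr (gC y x); ring. Qed.

Lemma si_sqrBC x y : g (x - y) (x - y) = g (y - x) (y - x).
Proof. by rewrite !si_sqrB (gC y x); ring. Qed.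

Lemma si_parallel x y :
  g (x + y) (x + y) + g (x - y) (x - y) = 2 * g x x + 2 * g y y.
Proof. rewrite si_sqrB gD !si_addr (gC y x); ring. Qed.

Lemma si_sqrD_le x y : g (x + y) (x + y) <= 2 * g x x + 2 * g y y.
Proof. by rewrite -si_parallel lerDl. Qed.

Lemma si_sqrB_le x y z :
  g (x - z) (x - z) <= 2 * g (x - y) (x - y) + 2 * g (y - z) (y - z).
Proof. by rewrite -[X in g X X](subrKA y) si_sqrD_le. Qed.

Lemma quadratic_ge0 (a b c : R) : 0 <= a -> 0 <= c ->
  (forall s, 0 <= c + 2 * s * b + s ^+ 2 * a) -> b ^+ 2 <= c * a.
Proof.
move=> a0 c0 h; have [a_eq0|an0] := eqVneq a 0.
  have [->|b0] := eqVneq b 0; first by rewrite expr0n a_eq0 mulr0.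
  (* Without a quadratic term this [s] gives the value [-1]; the other case uses the vertex
     [- b / a]. *)
  have := h (- (c + 1) / (2 * b)).
  rewrite a_eq0 mulr0 addr0.
  rewrite (_ : c + 2 * (- (c + 1) / (2 * b)) * b = -1); last by field.
  by move=> ?; exfalso; lra.
have ap : 0 < a by rewrite lt_neqAle eq_sym an0.
have := h (- b / a).
rewrite (_ : _ + _ = (c * a - b ^+ 2) / a); last by field.
by rewrite pmulr_lge0 ?invr_gt0// subr_ge0.
Qed.

Lemma si_cauchy_schwarz x y : g x y ^+ 2 <= g x x * g y y.
Proof. by apply: quadratic_ge0 => // s; rewrite -si_sqrD. Qed.

(** A minimiser of [g x x - 2 * f x] on [W] would represent [f], and the bound on [f] keeps this
    functional above [- C]. Without completeness a minimising sequence is the output; this suits M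
    with the 2-norm, where vectors are Cauchy sequences anyway. *)
Lemma riesz_approx (W : set V) (f : V -> R) (C : R) :
  real_subspace W -> 0 <= C ->
  (forall r x y, W x -> W y -> f (x + r%:C *: y) = f x + r * f y) ->
  (forall x, W x -> f x ^+ 2 <= C * g x x) ->
  exists w : nat -> V, [/\ forall k, W (w k),
    forall k l, g (w k - w l) (w k - w l) <= 2 * k.+1%:R^-1 + 2 * l.+1%:R^-1
  & forall k x, W x -> (f x - g (w k) x) ^+ 2 <= k.+1%:R^-1 * g x x].
Proof.
move=> [W0 Wl] C0 fl fb; pose p x := g x x - 2 * f x.
have pb x : W x -> - C <= p x.
  move=> /fb; have := g0 x; rewrite /p; set q := g x x => q0 h.
  rewrite leNgt; apply/negP => lt.
  have : (q + C) ^+ 2 < (2 * f x) ^+ 2 by rewrite ltr_sqr ?nnegrE; lra.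
  by have := sqr_ge0 (q - C); rewrite !expr2 in h *; lra.
pose P := [set p x | x in W]; pose m := inf P.
have lbP : has_lbound P by exists (- C) => _ [x Wx <-]; exact: pb.
have hP : has_inf P by split=> //; exists (p 0), 0.
have mle x : W x -> m <= p x by move=> Wx; apply: ge_inf => //; exists x.
have /choice[w hw] k : exists x, W x /\ p x < m + k.+1%:R^-1.
  have k0 : (0 : R) < k.+1%:R^-1 by rewrite invr_gt0.
  by have [_ [x Wx <-]] := inf_adherent k0 hP; exists x.
exists w; split=> [k|k l|k x Wx]; first by case: (hw k).
- have [Wk hk] := hw k; have [Wl' hl] := hw l.
  have Wd : W (w l - w k).
    by rewrite -scaleN1r -(rmorph1 (real_complex R)) -rmorphN; exact: Wl.
  (* Minimality at the midpoint of [w k] and [w l] bounds their distance, by the parallelogram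
     law. *)
  have /mle := Wl (2^-1) _ _ Wk Wd.
  have fe : f (w k + (2^-1)%:C *: (w l - w k)) = 2^-1 * f (w k) + 2^-1 * f (w l).
    have e : w l - w k = w l + (-1)%:C *: w k by rewrite rmorphN rmorph1 scaleN1r.
    by rewrite fl// e fl//; lra.
  rewrite /p in hk hl *; rewrite fe si_sqrD !si_sqrB si_addr si_oppr.
  rewrite (gC (w l) (w k)); move: hk hl.
  by rewrite expr2; move: (k.+1%:R^-1) (l.+1%:R^-1) => c d h1 h2 h3; lra.
- have [Wk hk] := hw k.
  (* Along the line [w k + s x] the functional stays above its infimum, so a quadratic in [s] is
     nonnegative and its discriminant is not positive. *)
  rewrite -sqrrN opprB; apply: quadratic_ge0; rewrite ?invr_ge0//.
  move=> s; have /mle := Wl s _ _ Wk Wx; rewrite /p fl// si_sqrD.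
  by move: hk; rewrite /p; move: (k.+1%:R^-1) => c h1 h2; lra.
Qed.

Definition si_closure (W : set V) : set V :=
  [set x | forall e : R, 0 < e -> exists2 w, W w & g (x - w) (x - w) < e].

Lemma natSinv_lt (e : R) : 0 < e ->
  exists K : nat, forall k, (K <= k)%N -> k.+1%:R^-1 < e.
Proof.
move=> e0; have /= [K _ hK] := near_infty_natSinv_lt (PosNum e0).
by exists K => k; exact: hK.
Qed.

Lemma le0_eps (x c : R) : 0 <= c -> (forall e : R, 0 < e -> x <= c * e) -> x <= 0.
Proof.
move=> c0 h; apply/ler_addgt0Pl => e e0; rewrite addr0; have c1 : 0 < c + 1 by lra.
have := h (e / (c + 1)); rewrite divr_gt0// => /(_ isT)/le_trans; apply.
rewrite mulrA ler_pdivrMr// mulrC ler_wpM2l ?ltW//; lra.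
Qed.

Lemma si_closure_sub (W : set V) : W `<=` si_closure W.
Proof. by move=> x Wx e e0; exists x; rewrite // subrr si_0l. Qed.

Lemma si_closure_idem (W : set V) : si_closure (si_closure W) `<=` si_closure W.
Proof.
move=> x hx e e0; have e4 : 0 < e / 4 by lra.
have [y /(_ _ e4)[w Ww hw] hy] := hx _ e4.
by exists w => //; apply: le_lt_trans (si_sqrB_le x y w) _; lra.
Qed.

Lemma si_closure_subspace (W : set V) :
  real_subspace W -> real_subspace (si_closure W).
Proof.
move=> [W0 Wl]; split; first exact: si_closure_sub.
move=> r x y hx hy e e0.
have e4 : 0 < e / 4 by lra.
have r1 : 0 < 4 * (r ^+ 2 + 1) by have := sqr_ge0 r; lra.
have [u Wu hu] := hx _ e4.
have [v Wv] := hy _ (divr_gt0 e0 r1); rewrite ltr_pdivlMr// => hv.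
exists (u + r%:C *: v); first exact: Wl.
have -> : x + r%:C *: y - (u + r%:C *: v) = (x - u) + r%:C *: (y - v).
  by rewrite opprD addrACA scalerBr.
apply: le_lt_trans (si_sqrD_le _ _) _; rewrite gZ si_scaler.
by have := g0 (y - v); have := sqr_ge0 r; rewrite expr2 in hv *; nra.
Qed.

Lemma si_closure_orth (W : set V) z q :
  (forall x, W x -> g z x = 0) -> si_closure W q -> g z q = 0.
Proof.
move=> hz hq; apply/eqP; rewrite -sqrf_eq0 eq_le sqr_ge0 andbT.
apply: (@le0_eps _ (g z z)) => // e e0; have [w Ww hw] := hq _ e0.
have -> : g z q = g z (q - w) by rewrite si_addr si_oppr (hz w)// subr0.
apply: le_trans (si_cauchy_schwarz _ _) _.
by rewrite ler_wpM2l// ltW.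
Qed.

Definition si_cauchy (u : nat -> V) := forall e : R, 0 < e ->
  exists K : nat, forall k l, (K <= k)%N -> (K <= l)%N ->
    g (u k - u l) (u k - u l) < e.

Definition si_complete := forall u, si_cauchy u ->
  exists x, forall e : R, 0 < e ->
    exists K : nat, forall k, (K <= k)%N -> g (u k - x) (u k - x) < e.

Lemma riesz_closure (W : set V) (f : V -> R) (C : R) :
  si_complete -> real_subspace W -> 0 <= C ->
  (forall r x y, W x -> W y -> f (x + r%:C *: y) = f x + r * f y) ->
  (forall x, W x -> f x ^+ 2 <= C * g x x) ->
  exists2 q, si_closure W q & forall x, W x -> f x = g q x.
Proof.
move=> cmpl Ws C0 fl fb.
have [w [Ww wc wf]] := riesz_approx Ws C0 fl fb.
have [|q hq] := cmpl w.
  move=> e e0; have e4 : 0 < e / 4 by lra.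
  have [K hK] := natSinv_lt e4; exists K => k l Kk Kl.
  apply: le_lt_trans (wc k l) _.
  move: (hK _ Kk) (hK _ Kl); move: (k.+1%:R^-1) (l.+1%:R^-1) => c d h1 h2; lra.
exists q.
  move=> e /hq[K hK]; exists (w K) => //.
  by rewrite si_sqrBC hK.
move=> x Wx; apply/eqP; rewrite -subr_eq0 -sqrf_eq0 eq_le sqr_ge0 andbT.
apply: (@le0_eps _ (4 * g x x)); first by rewrite mulr_ge0.
move=> e e0; have [K hK] := hq _ e0; have [K' hK'] := natSinv_lt e0.
set k := maxn K K'; have {}hK := hK k (leq_maxl _ _).
have {}hK' := hK' k (leq_maxr _ _).
have h1 := wf k x Wx; have h2 := si_cauchy_schwarz (w k - q) x.
have h3 := g0 x.
have -> : f x - g q x = (f x - g (w k) x) + g (w k - q) x.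
  by rewrite gD si_opp; ring.
move: (f x - g (w k) x) (g (w k - q) x) (g (w k - q) (w k - q)) hK h1 h2.
move: (k.+1%:R^-1) hK' => c hc a b d hd h1 h2.
have : (a + b) ^+ 2 <= 2 * a ^+ 2 + 2 * b ^+ 2.
  by rewrite -subr_ge0; have := sqr_ge0 (a - b); rewrite !expr2; lra.
have : c * g x x <= e * g x x by rewrite ler_wpM2r// ltW.
have : d * g x x <= e * g x x by rewrite ler_wpM2r// ltW.
by move=> h5 h6 h7; rewrite -mulrA (mulrC _ e); lra.
Qed.

End SemiInner.

Arguments si_closure {R V} g W.
Arguments si_cauchy {R V} g u.
Arguments si_complete {R V} g.

Lemma ltr0c (R : realType) (x : R) : (0 < x%:C) = (0 < x).
Proof. exact: (ltcR 0 x). Qed.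

Lemma linear_props (K : nzRingType) (U V : lmodType K) (f : U -> V) : linear f ->
  [/\ f 0 = 0, forall c x, f (c *: x) = c *: f x,
      forall x y, f (x + y) = f x + f y & forall x y, f (x - y) = f x - f y].
Proof.
move=> lf; pose fl : {linear U -> V} := HB.pack f (GRing.isLinear.Build _ _ _ _ f lf).
split=> *; [exact: (linear0 fl)|exact: (linearZ_LR fl)|exact: (linearD fl)|].
exact: (linearB fl).
Qed.

(** * Hilbert spaces and square summable sequences *)

Section Hilbert.
Context {R : realType} {H : hilbertType R}.
Implicit Types (x y : H) (T : H -> H).

Local Notation "<< x , y >>" := (inner H x y).

Lemma innerDl x y z : << x + y, z >> = << x, z >> + << y, z >>.
Proof. exact: linearDl. Qed.

Lemma innerZl (c : R[i]) x y : << c *: x, y >> = c * << x, y >>.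
Proof. exact: linearZl_LR. Qed.

Lemma innerC x y : << x, y >> = (<< y, x >>)^*.
Proof. by rewrite (@hermC _ false Num.conj) expr0 mul1r. Qed.

Lemma innerDr x y z : << x, y + z >> = << x, y >> + << x, z >>.
Proof. by rewrite innerC innerDl rmorphD (innerC x y) (innerC x z). Qed.

Lemma innerZr (c : R[i]) x y : << x, c *: y >> = c^* * << x, y >>.
Proof. by rewrite innerC innerZl rmorphM (innerC x y). Qed.

Definition rip x y : R := complex.Re << x, y >>.

Lemma rip_semi_inner : semi_inner rip.
Proof.
split=> [x y|x y z|r x y|x]; rewrite /rip.
- by rewrite innerC; case: << y, x >>.
- by rewrite innerDl raddfD.
- by rewrite innerZl; case: << x, y >> => a b /=; rewrite mul0r subr0.
- have : 0 <= << x, x >> by rewrite -inner_norm exprn_ge0.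
  by rewrite lecE => /andP[].
Qed.

Lemma rip_norm x : `|x| ^+ 2 = (rip x x)%:C.
Proof.
rewrite inner_norm /rip RRe_real// -inner_norm.
by rewrite realE exprn_ge0.
Qed.

Lemma rip_eq0 x : rip x x = 0 -> x = 0.
Proof.
move=> h; apply/normr0_eq0/eqP; rewrite -sqrf_eq0 rip_norm h.
by rewrite eqxx.
Qed.

Lemma inner_eq x y x' y' :
  (forall c : R[i], rip (c *: x) y = rip (c *: x') y') -> << x, y >> = << x', y' >>.
Proof.
move=> h; have := h 1; have := h 'i; rewrite /rip !innerZl !mul1r.
case: << x, y >> => a b; case: << x', y' >> => c d /=.
by rewrite !mul0r !sub0r !mul1r => /oppr_inj -> ->.
Qed.

Lemma norm_lt_rip x (e : R) : 0 < e -> (`|x| < e%:C) = (rip x x < e ^+ 2).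
Proof.
move=> e0; rewrite -ltr_sqr ?nnegrE//; last by rewrite ler0c ltW.
by rewrite rip_norm -rmorphXn ltcR.
Qed.

Lemma rip_complete : si_complete rip.
Proof.
move=> u hu.
have /cauchy_cvgP/cvg_ex[/= l hl] : cauchy (u @ \oo).
  apply: cauchy_exP => e e0.
  have eE : e = (complex.Re e)%:C by rewrite RRe_real// gtr0_real.
  move: e0; rewrite {}eE ltr0c; move: (complex.Re e) => {}e e0.
  have [K hK] := hu _ (exprn_gt0 2 e0).
  exists (u K), K => // k /= Kk.
  by rewrite -ball_normE /ball_/= norm_lt_rip// hK.
exists l => e e0.
have s0 : 0 < Num.sqrt e by rewrite sqrtr_gt0.
have sc : 0 < (Num.sqrt e)%:C :> R[i] by rewrite ltr0c.
have /cvgrPdist_lt/(_ _ sc)[K _ hK] := hl.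
exists K => k Kk; have := hK k Kk; rewrite norm_lt_rip// sqr_sqrtr ?ltW//.
by rewrite (si_sqrBC rip_semi_inner).
Qed.

Lemma bounded_operatorP T : bounded_operator T ->
  exists2 C : R, 0 <= C & forall x, rip (T x) (T x) <= C * rip x x.
Proof.
move=> [linT cT].
pose Tl : {linear H -> H} := HB.pack T (GRing.isLinear.Build _ _ _ _ T linT).
have /linear_boundedP/pinfty_ex_gt0[r r0 hr] : bounded_near Tl (nbhs 0).
  exact/linear_bounded_continuous.
have rE : r = (complex.Re r)%:C by rewrite RRe_real// gtr0_real.
exists ((complex.Re r) ^+ 2); first exact: sqr_ge0.
move=> x; rewrite -lecR -rip_norm.
have -> : ((complex.Re r) ^+ 2 * rip x x)%:C = (r * `|x|) ^+ 2.
  by rewrite exprMn rip_norm {2}rE -rmorphXn -rmorphM.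
by rewrite ler_sqr ?nnegrE// mulr_ge0// ltW.
Qed.

Lemma bounded_operatorW T (C : R) : linear T -> 0 <= C ->
  (forall x, rip (T x) (T x) <= C * rip x x) -> bounded_operator T.
Proof.
move=> linT C0 hC; split=> //.
pose Tl : {linear H -> H} := HB.pack T (GRing.isLinear.Build _ _ _ _ T linT).
apply: (@bounded_linear_continuous _ _ _ Tl).
apply/linear_boundedP; near=> r => x.
have r0 : 0 <= r by near: r; apply: nbhs_pinfty_ge; rewrite realE lexx.
rewrite -ler_sqr ?nnegrE ?mulr_ge0// exprMn !rip_norm.
apply: (@le_trans _ _ ((C + 1)%:C ^+ 2 * (rip x x)%:C)).
  rewrite -rmorphXn -rmorphM lecR; apply: le_trans (hC x) _.
  by rewrite ler_wpM2r ?(si_ge0 rip_semi_inner)// expr2; nra.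
rewrite ler_wpM2r ?ler0c ?(si_ge0 rip_semi_inner)//.
rewrite ler_sqr ?nnegrE ?ler0c; [|lra|done].
near: r; apply: nbhs_pinfty_ge; apply: ger0_real; rewrite ler0c; lra.
Unshelve. all: by end_near. Qed.

Lemma inner_inj y z : (forall x, << x, y >> = << x, z >>) -> y = z.
Proof.
move=> h; apply/eqP; rewrite -subr_eq0; apply/eqP/rip_eq0.
by rewrite /rip -scaleN1r innerDr innerZr h -{1}(mul1r << _, z >>) -mulrDl rmorphN
  rmorph1 subrr mul0r.
Qed.

Definition is_adjoint T T' := forall x y, << T x, y >> = << x, T' y >>.

Lemma is_adjointC T T' : is_adjoint T T' -> is_adjoint T' T.
Proof. by move=> h x y; rewrite innerC -h -innerC. Qed.

Lemma is_adjoint_rip T T' x y : is_adjoint T T' -> rip (T x) y = rip x (T' y).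
Proof. by rewrite /rip => ->. Qed.

(** [T' y] is the Riesz vector of [x |-> Re <T x, y>]. Real parts suffice because [x] may be scaled
    by any complex number. The bound on [T'] comes from [|T' y|^2 = Re <T (T' y), y>]. *)
Lemma adjoint_exists T : bounded_operator T ->
  exists2 T', bounded_operator T' & is_adjoint T T'.
Proof.
move=> bT; have [C C0 hC] := bounded_operatorP bT; have [linT _] := bT.
have [_ ZT _ _] := linear_props linT.
have /choice[T' hT'] y : exists q, forall x, rip (T x) y = rip q x.
  have [||| |q _ hq] := @riesz_closure _ _ _ rip_semi_inner setT
    (fun x => rip (T x) y) (C * rip y y) rip_complete.
  - by [].
  - by rewrite mulr_ge0 ?(si_ge0 rip_semi_inner).
  - move=> r x z _ _; rewrite addrC linT.
    by rewrite (si_add rip_semi_inner) (si_scale rip_semi_inner) addrC.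
  - move=> x _; apply: le_trans (si_cauchy_schwarz rip_semi_inner _ _) _.
    by rewrite mulrAC ler_wpM2r ?(si_ge0 rip_semi_inner).
  by exists q => x; exact: hq.
have adj : is_adjoint T T'.
  move=> x y; apply: inner_eq => c.
  by rewrite -ZT hT' (si_sym rip_semi_inner).
exists T' => //; apply: (bounded_operatorW _ C0).
  move=> c y z; apply: inner_inj => x.
  by rewrite -adj !innerDr !innerZr !adj.
move=> y; have [->|y0] := eqVneq (rip (T' y) (T' y)) 0.
  by rewrite mulr_ge0 ?(si_ge0 rip_semi_inner).
have yp : 0 < rip (T' y) (T' y).
  by rewrite lt_neqAle eq_sym y0 (si_ge0 rip_semi_inner).
rewrite -(ler_pM2l yp) -expr2 mulrA.
rewrite -[in X in X <= _](is_adjoint_rip _ _ adj).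
apply: le_trans (si_cauchy_schwarz rip_semi_inner _ _) _.
by rewrite ler_wpM2r ?(si_ge0 rip_semi_inner)// mulrC.
Qed.

End Hilbert.

Section SquareSummable.
Context {R : realType} {H : hilbertType R}.
Implicit Types (y z : nat -> H).

Let rP := @rip_semi_inner R H.

Definition sqsum y := exists C : R, forall n, \sum_(k < n) rip (y k) (y k) <= C.

Definition l2_pred : {pred nat -> H} := [pred y | `[< sqsum y >]].

Lemma l2_predP y : reflect (sqsum y) (y \in l2_pred).
Proof. by rewrite inE; exact: asboolP. Qed.

Lemma sqsum_operator T C y : 0 <= C -> (forall x, rip (T x) (T x) <= C * rip x x) ->
  sqsum y -> sqsum (T \o y).
Proof.
move=> C0 hC [D hD]; exists (C * D) => n.
apply: (@le_trans _ _ (C * \sum_(k < n) rip (y k) (y k))).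
  by rewrite mulr_sumr ler_sum// => k _; exact: hC.
by rewrite ler_wpM2l.
Qed.

Lemma sqsumD y z : sqsum y -> sqsum z -> sqsum (y + z).
Proof.
move=> [C hC] [D hD]; exists (2 * C + 2 * D) => n.
apply: (@le_trans _ _ (\sum_(k < n) (2 * rip (y k) (y k) + 2 * rip (z k) (z k)))).
  by apply: ler_sum => k _; exact: (si_sqrD_le rP).
rewrite big_split /= -!mulr_sumr.
by rewrite lerD// ler_wpM2l// ?hC ?hD.
Qed.

Lemma rip_scale (c : R[i]) (x : H) :
  rip (c *: x) (c *: x) = (complex.Re c ^+ 2 + complex.Im c ^+ 2) * rip x x.
Proof.
apply: (@complexI R).
by rewrite -rip_norm normrZ exprMn rmorphM /= -rip_norm add_Re2_Im2.
Qed.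

Lemma sqsumZ (c : R[i]) y : sqsum y -> sqsum (c *: y).
Proof.
apply: (@sqsum_operator (fun x => c *: x) (complex.Re c ^+ 2 + complex.Im c ^+ 2)).
  by rewrite addr_ge0 ?sqr_ge0.
by move=> x; rewrite rip_scale.
Qed.

Lemma l2_submod_closed : submod_closed l2_pred.
Proof.
split; first by apply/l2_predP; exists 0 => n; rewrite big1// => k _; exact: (si_0l rP).
by move=> c y z /l2_predP hy /l2_predP hz; apply/l2_predP/sqsumD => //; exact: sqsumZ.
Qed.

HB.instance Definition _ := GRing.isSubmodClosed.Build R[i] (nat -> H) l2_pred l2_submod_closed.

(** The Hilbert sum of countably many copies of [H]. On it an ultraweak functional, given by two
    square summable sequences, becomes an inner product with two vectors. *)
Record l2 := MkL2 { l2_val :> nat -> H; l2_valP : l2_val \in l2_pred }.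

HB.instance Definition _ := [isSub for l2_val].
HB.instance Definition _ := [Choice of l2 by <:].
HB.instance Definition _ := [SubChoice_isSubLmodule of l2 by <:].

Implicit Types (u v w : l2).

Lemma l2D u v k : (u + v) k = u k + v k. Proof. by []. Qed.
Lemma l2Z (c : R[i]) u k : (c *: u) k = c *: u k. Proof. by []. Qed.
Lemma l2N u k : (- u) k = - u k. Proof. by []. Qed.
Lemma l2_ext u v : (forall k, u k = v k) -> u = v.
Proof. by move=> h; apply: val_inj; apply: funext. Qed.

Definition l2ip u v : R := limn (series (fun k => rip (u k) (v k))).

Lemma sqsum_cvg u : cvgn (series (fun k => rip (u k) (u k))).
Proof.
have /l2_predP[C hC] := l2_valP u.
apply: nondecreasing_is_cvgn.
  by apply/nondecreasing_seqP => n; rewrite seriesEnat/= big_nat_recr//= lerDl si_ge0.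
by exists C => _ [n _ <-]; rewrite seriesEord; exact: hC.
Qed.

Lemma l2ip_cvg u v : series (fun k => rip (u k) (v k)) @ \oo --> l2ip u v.
Proof.
apply: normed_cvg.
apply: (@series_le_cvg _ _ (fun k => rip (u k) (u k) + rip (v k) (v k))).
- by move=> n; exact: normr_ge0.
- by move=> n; rewrite addr_ge0 ?si_ge0.
- move=> n /=; have := si_cauchy_schwarz rP (u n) (v n).
  have := si_ge0 rP (u n); have := si_ge0 rP (v n) => v0 u0 h.
  rewrite -ler_sqr ?nnegrE ?addr_ge0// real_normK ?num_real//.
  by apply: le_trans h _; rewrite expr2; nra.
by apply: is_cvg_seriesD; exact: sqsum_cvg.
Qed.

Lemma l2ip_unique u v (a : R) :
  series (fun k => rip (u k) (v k)) @ \oo --> a -> l2ip u v = a.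
Proof. by move=> h; apply: cvg_lim. Qed.

Lemma l2ip_semi_inner : semi_inner l2ip.
Proof.
split=> [u v|u v w|r u v|u].
- apply: l2ip_unique; under eq_fun do rewrite (si_sym rP).
  exact: l2ip_cvg.
- apply: l2ip_unique.
  have := cvgD (@l2ip_cvg u w) (@l2ip_cvg v w).
  rewrite (_ : _ + _ = series (fun k => rip ((u + v) k) (w k))); first exact.
  apply: funext => n; rewrite fctE !seriesEnat /= -big_split; apply: eq_bigr => k _.
  by rewrite /= (si_add rP).
- apply: l2ip_unique.
  rewrite (_ : series _ = fun n => r * series (fun k => rip (u k) (v k)) n).
    by apply: cvgM; [exact: cvg_cst|exact: l2ip_cvg].
  apply: funext => n; rewrite !seriesEnat /= mulr_sumr; apply: eq_bigr => k _.
  by rewrite /= (si_scale rP).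
- apply: limr_ge; first exact: sqsum_cvg.
  by near=> n; rewrite seriesEnat /= sumr_ge0// => k _; rewrite si_ge0.
Unshelve. all: by end_near. Qed.

Let lP := l2ip_semi_inner.

Lemma l2ip_le u (C : R) :
  (forall n, \sum_(k < n) rip (u k) (u k) <= C) -> l2ip u u <= C.
Proof.
move=> h; apply: limr_le; first exact: sqsum_cvg.
by near=> n; rewrite seriesEord; exact: h.
Unshelve. all: by end_near. Qed.

Lemma l2ip_ge u n : \sum_(k < n) rip (u k) (u k) <= l2ip u u.
Proof.
have h : nondecreasing_seq (series (fun k => rip (u k) (u k))).
  by apply/nondecreasing_seqP => m; rewrite seriesEnat/= big_nat_recr//= lerDl si_ge0.
by have := nondecreasing_cvgn_le h (@sqsum_cvg u) n; rewrite {1}seriesEord.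
Qed.

Lemma l2ip_coord u k : rip (u k) (u k) <= l2ip u u.
Proof.
apply: le_trans (l2ip_ge u k.+1); rewrite big_ord_recr/= lerDr.
by rewrite sumr_ge0// => i _; rewrite si_ge0.
Qed.

Lemma l2ip_eq0 u : l2ip u u = 0 -> u = 0.
Proof.
move=> h; apply: l2_ext => k; apply: rip_eq0; apply/eqP.
by rewrite eq_le si_ge0// -h l2ip_coord.
Qed.

Lemma l2_complete : si_complete l2ip.
Proof.
move=> u hu.
have /choice[x hx] k : exists x, forall e : R, 0 < e ->
    exists K : nat, forall n, (K <= n)%N -> rip (u n k - x) (u n k - x) < e.
  apply: rip_complete => e /hu[K hK]; exists K => n m Kn Km.
  apply: le_lt_trans (hK n m Kn Km).
  exact: (l2ip_coord (u n - u m)).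
have psum N (e : R) : 0 < e -> exists K : nat, forall n, (K <= n)%N ->
    \sum_(k < N) rip (u n k - x k) (u n k - x k) < e.
  elim: N e => [|N IH] e e0; first by exists 0 => n _; rewrite big_ord0.
  have e2 : 0 < e / 2 by lra.
  have [K hK] := IH _ e2; have [L hL] := hx N _ e2.
  exists (maxn K L) => n; rewrite geq_max => /andP[Kn Ln].
  by rewrite big_ord_recr /= (splitr e) ltrD ?hK ?hL.
(* The bound has to be uniform in [N]. It comes from comparison with a late term [u m], where [m]
   may depend on [N]. *)
have hle (e : R) : 0 < e -> exists K : nat, forall n, (K <= n)%N -> forall N,
    \sum_(k < N) rip (u n k - x k) (u n k - x k) <= e.
  move=> e0; have e4 : 0 < e / 4 by lra.
  have [K hK] := hu _ e4; exists K => n Kn N.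
  have [L hL] := psum N _ e4; set m := maxn K L.
  apply: (@le_trans _ _ (\sum_(k < N)
    (2 * rip ((u n - u m) k) ((u n - u m) k) +
     2 * rip (u m k - x k) (u m k - x k)))).
    by apply: ler_sum => k _; exact: (si_sqrB_le rP).
  rewrite big_split /= -!mulr_sumr.
  have h1 := hL m (leq_maxr _ _); have h2 := hK n m Kn (leq_maxl _ _).
  have h3 := l2ip_ge (u n - u m) N; lra.
have xP : sqsum x.
  have [K hK] := hle 1 ltr01.
  have -> : x = (u K : nat -> H) + (-1) *: ((u K : nat -> H) + (-1) *: x).
    apply: funext => k /=.
    by rewrite fctE /= !scaleN1r opprD opprK addrA subrr add0r.
  apply: sqsumD; first exact/l2_predP/l2_valP.
  apply: sqsumZ; exists 1 => n; under eq_bigr do rewrite fctE /= scaleN1r.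
  exact: hK.
have xP' : x \in l2_pred by exact/l2_predP.
exists (MkL2 xP') => e e0; have e2 : 0 < e / 2 by lra.
have [K hK] := hle _ e2; exists K => n Kn.
apply: (@le_lt_trans _ _ (e / 2)); last by lra.
by apply: l2ip_le => N; exact: hK.
Qed.

End SquareSummable.

Arguments l2 {R} H.

(** * Amplification of operators to the Hilbert sum *)

Section Amplification.
Context {R : realType} {H : hilbertType R}.
Implicit Types (T : H -> H) (u v w : l2 H) (x y : H).

Let rP := @rip_semi_inner R H.
Let lP := @l2ip_semi_inner R H.

(** The operator [T (x) 1] on the Hilbert sum. The default value 0 is taken only if [T \o u] is not
    square summable, which a bounded [T] excludes. *)
Definition amp T u : l2 H := insubd 0 (T \o (u : nat -> H)).

Lemma ampE T u k : bounded_operator T -> amp T u k = T (u k).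
Proof.
move=> bT; have [C C0 hC] := bounded_operatorP bT.
rewrite /amp -[l2_val]/val val_insubd ifT//.
by apply/l2_predP/(sqsum_operator C0 hC)/l2_predP/l2_valP.
Qed.

Lemma ampD T u v : bounded_operator T -> amp T (u + v) = amp T u + amp T v.
Proof.
move=> bT; apply: l2_ext => k; rewrite l2D !ampE// l2D.
by have [_ _ -> _] := linear_props bT.1.
Qed.

Lemma ampZ T c u : bounded_operator T -> amp T (c *: u) = c *: amp T u.
Proof.
move=> bT; apply: l2_ext => k; rewrite l2Z !ampE// l2Z.
by have [_ -> _ _] := linear_props bT.1.
Qed.

Lemma ampB T u v : bounded_operator T -> amp T (u - v) = amp T u - amp T v.
Proof. by move=> bT; rewrite -scaleN1r ampD// ampZ// scaleN1r. Qed.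

Lemma amp_bound T (C : R) u : bounded_operator T ->
  (forall x, rip (T x) (T x) <= C * rip x x) -> 0 <= C ->
  l2ip (amp T u) (amp T u) <= C * l2ip u u.
Proof.
move=> bT hC C0; apply: l2ip_le => n.
apply: (@le_trans _ _ (C * \sum_(k < n) rip (u k) (u k))).
  by rewrite mulr_sumr ler_sum// => k _; rewrite ampE//.
by rewrite ler_wpM2l// l2ip_ge.
Qed.

Lemma amp_adj T T' u v : bounded_operator T -> bounded_operator T' ->
  is_adjoint T T' -> l2ip (amp T u) v = l2ip u (amp T' v).
Proof.
move=> bT bT' a; apply: l2ip_unique.
rewrite (_ : (fun k => _) = fun k => rip (u k) (amp T' v k)); first exact: l2ip_cvg.
by apply: funext => k; rewrite !ampE//; exact: is_adjoint_rip.
Qed.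

Lemma scale_bounded (c : R[i]) : bounded_operator (fun x : H => c *: x).
Proof.
apply: (@bounded_operatorW _ _ _ (complex.Re c ^+ 2 + complex.Im c ^+ 2)).
- by move=> a x y; rewrite scalerDr !scalerA mulrC.
- by rewrite addr_ge0 ?sqr_ge0.
- by move=> x; rewrite rip_scale.
Qed.

Lemma single_pred k x : (fun j => if j == k then x else 0) \in @l2_pred R H.
Proof.
apply/l2_predP; exists (rip x x) => n.
have [kn|nk] := ltnP k n.
  rewrite (bigD1 (Ordinal kn))//= eqxx big1 ?addr0// => i /negPf ik.
  by rewrite -(inj_eq val_inj) /= in ik; rewrite ik (si_0l rP).
rewrite big1 ?si_ge0// => i _; rewrite ifF ?(si_0l rP)//.
by apply/negP => /eqP ik; move: (ltn_ord i); rewrite ik ltnNge nk.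
Qed.

Definition single k x : l2 H := MkL2 (single_pred k x).

Lemma singleE k x j : single k x j = if j == k then x else 0. Proof. by []. Qed.

Lemma l2ip_single u k x : l2ip u (single k x) = rip (u k) x.
Proof.
apply: l2ip_unique; apply: cvg_near_cst; near=> n.
have kn : (k < n)%N by near: n; exact: nbhs_infty_gt.
rewrite seriesEord /= (bigD1 (Ordinal kn))//= eqxx big1 ?addr0// => i /negPf ik.
by rewrite -(inj_eq val_inj) /= in ik; rewrite ik (si_0r rP).
Unshelve. all: by end_near. Qed.

Lemma amp_single T k x : bounded_operator T -> amp T (single k x) = single k (T x).
Proof.
move=> bT; apply: l2_ext => j; rewrite ampE// !singleE.
by case: ifP => // _; have [-> _ _ _] := linear_props bT.1.
Qed.

Lemma single_lin k c x y : single k (c *: x + y) = c *: single k x + single k y.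
Proof.
apply: l2_ext => j; rewrite l2D l2Z !singleE.
by case: ifP => // _; rewrite scaler0 addr0.
Qed.

(** Finite sums of [single] vectors are where commutation with a projection can be checked one
    matrix entry at a time; they are dense. *)
Definition trunc u n : l2 H := \sum_(k < n) single k (u k).

Lemma truncE u n j : trunc u n j = if (j < n)%N then u j else 0.
Proof.
rewrite /trunc; elim: n => [|n IH]; first by rewrite big_ord0.
rewrite big_ord_recr l2D {}IH singleE /= ltnS (leq_eqVlt j).
by case: (eqVneq j n) => [->|_] /=; rewrite ?ltnn ?add0r ?addr0.
Qed.

Lemma trunc_cvg u (e : R) : 0 < e -> exists n, l2ip (u - trunc u n) (u - trunc u n) < e.
Proof.
move=> e0; have /cvgrPdist_lt/(_ _ e0)[n _ /(_ n (leqnn n))/=] := @l2ip_cvg _ _ u u.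
rewrite seriesEord /= => h; exists n; apply: le_lt_trans h.
have tl v : l2ip v (trunc u n) = \sum_(k < n) rip (v k) (u k).
  by rewrite (si_sumr lP); apply: eq_bigr => k _; rewrite l2ip_single.
rewrite (si_sqrB lP) !tl.
have -> : \sum_(k < n) rip (trunc u n k) (u k) = \sum_(k < n) rip (u k) (u k).
  by apply: eq_bigr => k _; rewrite truncE ltn_ord.
set s := \sum_(k < n) _; apply: le_trans (ler_norm _); lra.
Qed.

End Amplification.

(** * The double commutant theorem *)

Section DoubleCommutant.
Context {R : realType} {H : hilbertType R}.
Implicit Types (T S : H -> H) (u v w : l2 H) (x y : H).

Let lP := @l2ip_semi_inner R H.

Variable A : set (H -> H).
Hypothesis A_bounded : forall T, A T -> bounded_operator T.
Hypothesis A_id : A id.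
Hypothesis A_comb : forall c T S, A T -> A S -> A (fun x => c *: T x + S x).
Hypothesis A_comp : forall T S, A T -> A S -> A (T \o S).
Hypothesis A_adj : forall T, A T -> exists2 T', A T' & is_adjoint T T'.

Variable zeta : l2 H.

Let W : set (l2 H) := [set amp T zeta | T in A].

Let A_scale c : A (fun x : H => c *: x).
Proof.
have A0 : A (fun x : H => 0).
  by have := A_comb (-1) A_id A_id; congr A; apply: funext => x; rewrite scaleN1r addNr.
by have := A_comb c A_id A0; congr A; apply: funext => x; rewrite addr0.
Qed.

Let W_subspace : real_subspace W.
Proof.
split.
  exists (fun x => 0 *: x); first exact: A_scale.
  apply: l2_ext => k; rewrite ampE ?scale0r//; exact: scale_bounded.
move=> r _ _ [T AT <-] [S AS <-].
exists (fun x => r%:C *: S x + T x); first exact: A_comb.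
have bT := A_bounded AT; have bS := A_bounded AS.
have bTS := A_bounded (A_comb r%:C AS AT).
by apply: l2_ext => k; rewrite l2D l2Z !ampE// addrC.
Qed.

Let W_amp T w : A T -> W w -> W (amp T w).
Proof.
move=> AT [S AS <-]; exists (T \o S); first exact: A_comp.
have bT := A_bounded AT; have bS := A_bounded AS.
have bTS := A_bounded (A_comp AT AS).
by apply: l2_ext => k; rewrite !ampE.
Qed.

Let clW_amp T w : A T -> si_closure l2ip W w -> si_closure l2ip W (amp T w).
Proof.
move=> AT hw e e0; have bT := A_bounded AT.
have [C C0 hC] := bounded_operatorP bT.
have C1 : 0 < C + 1 by lra.
have [v Wv] := hw _ (divr_gt0 e0 C1); rewrite ltr_pdivlMr// => hv.
exists (amp T v); first exact: W_amp.
rewrite -ampB//; apply: le_lt_trans (amp_bound _ bT hC C0) _.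
apply: le_lt_trans hv; rewrite mulrC ler_wpM2l ?si_ge0//; lra.
Qed.

Let proj_exists u : exists q, si_closure l2ip W q /\
  forall w, W w -> l2ip u w = l2ip q w.
Proof.
have [||| |q hq h] := @riesz_closure _ _ _ lP W (l2ip u) (l2ip u u) (@l2_complete R H).
- exact: W_subspace.
- exact: si_ge0.
- by move=> r x y _ _; rewrite (si_addr lP) (si_scaler lP).
- by move=> x _; exact: si_cauchy_schwarz.
by exists q.
Qed.

Let Q u : l2 H := sval (cid (proj_exists u)).

Let Q_cl u : si_closure l2ip W (Q u).
Proof. by rewrite /Q; case: cid => q []. Qed.

Let Q_ip u w : W w -> l2ip u w = l2ip (Q u) w.
Proof. by rewrite /Q; case: cid => q [? h]; exact: h. Qed.

Let Q_unique u q : si_closure l2ip W q ->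
  (forall w, W w -> l2ip u w = l2ip q w) -> Q u = q.
Proof.
move=> hq h; apply/eqP; rewrite -subr_eq0; apply/eqP/l2ip_eq0.
apply: (si_closure_orth lP) (_ : si_closure l2ip W _) => [w Ww|].
  by rewrite (si_add lP) (si_opp lP) -Q_ip// h// subrr.
have [_ cl] := si_closure_subspace lP W_subspace.
have -> : Q u - q = Q u + (-1)%:C *: q by rewrite rmorphN rmorph1 scaleN1r.
exact: cl (Q_cl u) hq.
Qed.

Let Q_amp T u : A T -> Q (amp T u) = amp T (Q u).
Proof.
move=> AT; apply: Q_unique; first exact/clW_amp/Q_cl.
move=> w Ww; have [T' AT' aT] := A_adj AT.
rewrite !(amp_adj _ _ _ _ aT); try exact: A_bounded.
exact/Q_ip/W_amp.
Qed.

Let QZ c u : Q (c *: u) = c *: Q u.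
Proof.
have e v : c *: v = amp (fun x => c *: x) v.
  by apply: l2_ext => k; rewrite ampE//; exact: scale_bounded.
by rewrite !e Q_amp.
Qed.

Let QD u v : Q (u + v) = Q u + Q v.
Proof.
apply: Q_unique => [|w Ww]; last by rewrite !(si_add lP) -!Q_ip.
have [_ cl] := si_closure_subspace lP W_subspace.
have -> : Q u + Q v = Q u + (1)%:C *: Q v by rewrite rmorph1 scale1r.
exact: cl (Q_cl u) (Q_cl v).
Qed.

Let QB u v : Q (u - v) = Q u - Q v.
Proof. by rewrite -scaleN1r QD QZ scaleN1r. Qed.

Let Q_contract u : l2ip (Q u) (Q u) <= l2ip u u.
Proof.
have h : l2ip u (Q u) = l2ip (Q u) (Q u).
  apply/eqP; rewrite -subr_eq0 -(si_opp lP) -(si_add lP); apply/eqP.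
  apply: (si_closure_orth lP) (@Q_cl u) => w Ww.
  by rewrite (si_add lP) (si_opp lP) -Q_ip// subrr.
have := si_cauchy_schwarz lP u (Q u); rewrite h.
have := si_ge0 lP (Q u); rewrite le_eqVlt => /predU1P[<- _|p].
  exact: si_ge0.
by rewrite expr2 ler_pM2r.
Qed.

Let Qz : Q zeta = zeta.
Proof.
apply: Q_unique => //; apply: (si_closure_sub lP); exists id => //.
by apply: l2_ext => k; rewrite ampE//; exact: A_bounded.
Qed.

(* The matrix entries of the projection onto the closure of A zeta lie in the
   commutant of A. *)
Let Q_entry k l : commutant A (fun x => Q (single l x) k).
Proof.
split.
  apply: (@bounded_operatorW _ _ _ 1) => // [c x y|x].
    by rewrite single_lin QD QZ l2D l2Z.
  have -> : rip x x = l2ip (single l x) (single l x).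
    by rewrite l2ip_single singleE eqxx.
  by rewrite mul1r; apply: le_trans (l2ip_coord _ _) (Q_contract _).
move=> T AT; apply: funext => x /=; have bT := A_bounded AT.
by rewrite -amp_single// Q_amp// ampE.
Qed.

Variable t : H -> H.
Hypothesis tP : commutant (commutant A) t.

Let Q_commute_single l x : Q (amp t (single l x)) = amp t (Q (single l x)).
Proof.
apply: l2_ext => k; rewrite amp_single ?ampE; [|exact: tP.1|exact: tP.1].
by have := congr1 (fun f => f x) (tP.2 _ (Q_entry k l)).
Qed.

Let Q_commute_trunc u n : Q (amp t (trunc u n)) = amp t (Q (trunc u n)).
Proof.
rewrite /trunc; elim: n => [|n IH].
  rewrite big_ord0 -(scale0r 0) ampZ ?QZ ?scale0r; last exact: tP.1.
  by rewrite -(scale0r (0 : l2 H)) ampZ ?scale0r//; exact: tP.1.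
rewrite big_ord_recr /= ampD ?QD ?IH ?Q_commute_single ?ampD//; exact: tP.1.
Qed.

(** [Q] commutes with [amp t] on finitely supported vectors, because its matrix entries commute with
    [t]. As [Q zeta = zeta], the vector [amp t zeta] is a limit of the vectors
    [Q (amp t (trunc zeta n))], which lie in the closure of [A zeta]. *)
Lemma bicommutant_approx (e : R) : 0 < e ->
  exists2 T, A T & l2ip (amp t zeta - amp T zeta) (amp t zeta - amp T zeta) < e.
Proof.
move=> e0; have bt := tP.1; have [C C0 hC] := bounded_operatorP bt.
suff /(_ e e0)[_ [T AT <-] h] : si_closure l2ip W (amp t zeta) by exists T.
apply: (si_closure_idem lP) => {}e {}e0.
have C1 : 0 < C + 1 by lra.
have [n] := trunc_cvg zeta (divr_gt0 e0 C1); rewrite ltr_pdivlMr// => hn.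
exists (Q (amp t (trunc zeta n))); first exact: Q_cl.
have -> : amp t zeta - Q (amp t (trunc zeta n)) = amp t (Q (zeta - trunc zeta n)).
  by rewrite Q_commute_trunc QB ampB// Qz.
apply: le_lt_trans (amp_bound _ bt hC C0) _.
apply: le_lt_trans hn; rewrite mulrC ler_pM ?si_ge0 ?Q_contract//; lra.
Qed.

End DoubleCommutant.

(** * Complex limits and ultraweak forms through real parts *)

Section ComplexLimits.
Context {R : realType}.

Lemma normc_le_ReIm (z : R[i]) :
  `|z| <= (`|complex.Re z| + `|complex.Im z|)%:C.
Proof.
rewrite normc_def lecR -[leRHS]ger0_norm ?addr_ge0// -sqrtr_sqr ler_wsqrtr//.
have := normr_ge0 (complex.Re z); have := normr_ge0 (complex.Im z).
rewrite -(real_normK (num_real (complex.Re z))) -(real_normK (num_real (complex.Im z))).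
by move: `|_| `|_| => a b a0 b0; rewrite !expr2; nra.
Qed.

Lemma cvg_complex (u : nat -> R[i]) (a b : R) :
  (fun k => complex.Re (u k)) @ \oo --> a ->
  (fun k => complex.Im (u k)) @ \oo --> b ->
  (u : nat -> R[i]^o) @ \oo --> (Complex a b : R[i]^o).
Proof.
move=> ha hb; apply/cvgrPdist_lt => e e0.
have eE : e = (complex.Re e)%:C by rewrite RRe_real// gtr0_real.
move: e0; rewrite {}eE ltr0c; move: (complex.Re e) => {}e e0.
have e2 : 0 < e / 2 by lra.
move/cvgrPdist_lt/(_ _ e2) : ha => ha; move/cvgrPdist_lt/(_ _ e2) : hb => hb.
near=> n; apply: le_lt_trans (normc_le_ReIm _) _.
rewrite ltcR (splitr e) ltrD//.
  have -> : complex.Re (Complex a b - u n) = a - complex.Re (u n) by case: (u n).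
  by near: n.
have -> : complex.Im (Complex a b - u n) = b - complex.Im (u n) by case: (u n).
by near: n.
Unshelve. all: by end_near. Qed.

Lemma cvg_Re (u : nat -> R[i]) (z : R[i]) :
  (u : nat -> R[i]^o) @ \oo --> (z : R[i]^o) ->
  (fun k => complex.Re (u k)) @ \oo --> complex.Re z.
Proof.
move=> /cvgrPdist_lt h; apply/cvgrPdist_lt => e e0; near=> n.
rewrite -ltcR; apply: (@le_lt_trans _ _ `|z - u n|); last first.
  by near: n; apply: h; rewrite ltr0c.
by have := normc_ge_Re (z - u n); case: (z) => ? ?; case: (u n) => ? ?.
Unshelve. all: by end_near. Qed.

End ComplexLimits.

Section L2Forms.
Context {R : realType} {H : hilbertType R}.
Implicit Types (u v w : l2 H).

Let rP := @rip_semi_inner R H.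
Let lP := @l2ip_semi_inner R H.

Lemma Re_series (f : nat -> R[i]) :
  (fun n => complex.Re (series f n)) = series (fun k => complex.Re (f k)).
Proof.
apply: funext => n; rewrite !seriesEord/=.
by elim/big_ind2 : _ => // x1 x2 y1 y2 <- <-; rewrite raddfD.
Qed.

Lemma Im_series (f : nat -> R[i]) :
  (fun n => complex.Im (series f n)) = series (fun k => complex.Im (f k)).
Proof.
apply: funext => n; rewrite !seriesEord/=.
by elim/big_ind2 : _ => // x1 x2 y1 y2 <- <-; rewrite raddfD.
Qed.

Lemma square_summable_sqsum (y : nat -> H) : square_summable y -> sqsum y.
Proof.
move=> /cvg_ex[/= l /cvg_Re]; rewrite Re_series => hl.
have hc : cvgn (series (fun k => rip (y k) (y k))).
  apply/cvg_ex; exists (complex.Re l); move: hl.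
  rewrite (_ : (fun k => complex.Re _) = (fun k => rip (y k) (y k)))//.
  by apply: funext => k; rewrite rip_norm.
exists (limn (series (fun k => rip (y k) (y k)))) => n.
have h : nondecreasing_seq (series (fun k => rip (y k) (y k))).
  by apply/nondecreasing_seqP => m; rewrite seriesEnat/= big_nat_recr//= lerDl (si_ge0 rP).
by have := nondecreasing_cvgn_le h hc n; rewrite {1}seriesEord.
Qed.

(** The imaginary part of [<x, y>] is the real part of [<x, i y>], so both parts are real inner
    products on the Hilbert sum. *)
Lemma l2_inner_cvg u v :
  (series (fun k => inner H (u k) (v k)) : nat -> R[i]^o) @ \oo -->
  (Complex (l2ip u v) (l2ip u ('i *: v)) : R[i]^o).
Proof.
apply: cvg_complex; rewrite ?Re_series ?Im_series; first exact: l2ip_cvg.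
rewrite (_ : (fun k => _) = fun k => rip (u k) (('i *: v) k)); first exact: l2ip_cvg.
apply: funext => k; rewrite l2Z /rip innerZr.
by case: (inner H _ _) => a b /=; rewrite !(mul0r, mulN1r, opprK, sub0r, add0r).
Qed.

Lemma l2ip_mean u v : `|l2ip u v| <= (l2ip u u + l2ip v v) / 2.
Proof.
have h1 := si_ge0 lP (u - v); have h2 := si_ge0 lP (u + (1)%:C *: v).
rewrite ler_norml; rewrite (si_sqrB lP) in h1; rewrite (si_sqrD lP) in h2.
by rewrite expr2 in h2; apply/andP; split; lra.
Qed.

Lemma l2ip_scale_i u : l2ip ('i *: u) ('i *: u) = l2ip u u.
Proof.
apply: l2ip_unique; under eq_fun do rewrite l2Z rip_scale /= expr0n expr1n add0r mul1r.
exact: l2ip_cvg.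
Qed.

(** Interleaving the two sequences adds the squared norms of [T u] and [T v]. In this way the
    finitely many vectors of an ultraweak neighbourhood are replaced by a single one. *)
Lemma l2_merge u v : exists w, forall T, bounded_operator T ->
  l2ip (amp T u) (amp T u) <= l2ip (amp T w) (amp T w) /\
  l2ip (amp T v) (amp T v) <= l2ip (amp T w) (amp T w).
Proof.
pose y k := if odd k then v k./2 else u k./2.
have sy (f : H -> R) n :
    \sum_(k < n.*2) f (y k) = \sum_(k < n) f (u k) + \sum_(k < n) f (v k).
  elim: n => [|n IH]; first by rewrite !big_ord0 addr0.
  rewrite doubleS !big_ord_recr /= IH /y /= odd_double /= uphalf_double doubleK.
  by rewrite addrACA -!addrA.
have yP : y \in @l2_pred R H.
  have /l2_predP[C hC] := l2_valP u; have /l2_predP[D hD] := l2_valP v.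
  apply/l2_predP; exists (C + D) => n.
  apply: (@le_trans _ _ (\sum_(k < n.*2) rip (y k) (y k))).
    rewrite -addnn big_split_ord/= lerDl sumr_ge0// => i _; exact: (si_ge0 rP).
  by rewrite (sy (fun x => rip x x)) lerD ?hC ?hD.
exists (MkL2 yP) => T bT; split; apply: l2ip_le => n.
  under eq_bigr do rewrite ampE//.
  apply: le_trans (l2ip_ge _ n.*2); under [leRHS]eq_bigr do rewrite ampE//.
  rewrite (sy (fun x => rip (T x) (T x))) lerDl sumr_ge0// => i _.
  exact: (si_ge0 rP).
under eq_bigr do rewrite ampE//.
apply: le_trans (l2ip_ge _ n.*2); under [leRHS]eq_bigr do rewrite ampE//.
rewrite (sy (fun x => rip (T x) (T x))) lerDr sumr_ge0// => i _.
exact: (si_ge0 rP).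
Qed.

Lemma l2_merge_seq (I : Type) (s : seq I) (u : I -> l2 H) : exists w,
  forall T i, bounded_operator T -> List.In i s ->
  l2ip (amp T (u i)) (amp T (u i)) <= l2ip (amp T w) (amp T w).
Proof.
elim: s => [|i s [w hw]]; first by exists 0.
have [w' hw'] := l2_merge (u i) w; exists w' => T j bT /= [<-|js].
  by case: (hw' T bT).
by apply: le_trans (hw T j bT js) _; case: (hw' T bT).
Qed.

End L2Forms.

(** * Traces and the 2-norm *)

Section TracialBasics.
Context {R : realType} {M : tracialWType R}.
Implicit Types (a b : M) (c : R[i]).

Lemma rep_is_linear (x : Defs.space M) : linear (rep^~ x : M -> Defs.space M).
Proof. by move=> c a b; rewrite rep_linear. Qed.

Lemma repB a b x : rep (a - b) x = rep a x - rep b x :> Defs.space M.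
Proof. by have [_ _ _ ->] := linear_props (rep_is_linear x). Qed.

Lemma rep_ext a b : (forall x, rep a x = rep b x) -> a = b.
Proof. by move=> h; apply: rep_inj; apply: funext. Qed.

Lemma rep_adjoint a : is_adjoint (rep a) (rep (star a)).
Proof. by move=> x y; exact: rep_star. Qed.

Lemma star_unique a b : (forall x y, inner (Defs.space M) (rep a x) y =
  inner (Defs.space M) x (rep b y)) -> star a = b.
Proof.
move=> h; apply: rep_ext => y; apply: inner_inj => x.
by rewrite -rep_adjoint h.
Qed.

Lemma starK a : star (star a) = a.
Proof. by apply: star_unique => x y; rewrite (is_adjointC (@rep_adjoint a)). Qed.

Lemma starM a b : star (a * b) = star b * star a.
Proof. by apply: star_unique => x y; rewrite !repM !rep_adjoint. Qed.

Lemma star1 : star 1 = 1 :> M.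
Proof. by apply: star_unique => x y; rewrite !rep1. Qed.

Lemma starZD c a b : star (c *: a + b) = c^* *: star a + star b.
Proof.
by apply: star_unique => x y; rewrite !rep_linear innerDl innerZl innerDr innerZr
  conjCK !rep_adjoint.
Qed.

Lemma starD a b : star (a + b) = star a + star b.
Proof. by rewrite -[a]scale1r starZD rmorph1 !scale1r. Qed.

Lemma star0 : star 0 = 0 :> M.
Proof. by apply: (addrI (star 0)); rewrite -starD !addr0. Qed.

Lemma starZ c a : star (c *: a) = c^* *: star a.
Proof. by rewrite -[c *: a]addr0 starZD star0 addr0. Qed.

Lemma starN a : star (- a) = - star a.
Proof. by rewrite -scaleN1r starZ rmorphN rmorph1 scaleN1r. Qed.

Lemma starB a b : star (a - b) = star a - star b.
Proof. by rewrite starD starN. Qed.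

Lemma tauD a b : tau (a + b) = tau a + tau b.
Proof. by rewrite -[a]scale1r tau_linear mul1r scale1r. Qed.

Lemma tau0 : tau (0 : M) = 0 :> R[i].
Proof. by apply: (addrI (tau (0 : M))); rewrite -tauD !addr0. Qed.

Lemma tauZ c a : tau (c *: a) = c * tau a.
Proof. by rewrite -[c *: a]addr0 tau_linear tau0 addr0. Qed.

Lemma tauN a : tau (- a) = - tau a.
Proof. by rewrite -scaleN1r tauZ mulN1r. Qed.

Lemma tauB a b : tau (a - b) = tau a - tau b.
Proof. by rewrite tauD tauN. Qed.

Lemma tau_sum (I : Type) (s : seq I) (F : I -> M) :
  tau (\sum_(i <- s) F i) = \sum_(i <- s) tau (F i).
Proof. by elim: s => [|i s IH]; rewrite ?big_nil ?tau0// !big_cons tauD IH. Qed.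

(** Polarisation: [tau (b * star b)] is real, and for [b = a + c] with [c = 1] and [c = i] this
    gives the imaginary and the real part of the identity. *)
Lemma tau_star a : tau (star a) = (tau a)^*.
Proof.
have real b : complex.Im (tau (b * star b)) = 0 by exact/ger0_Im/tau_ge0.
have h c : complex.Im (c^* * tau a + c * tau (star a)) = 0.
  have := real (a + c *: 1); rewrite starD starZ star1 mulrDr !mulrDl.
  rewrite -!scalerAr -!scalerAl !mul1r !mulr1 !tauD !tauZ tau1 mulr1.
  rewrite !raddfD /= real add0r.
  have -> : complex.Im (c^* * c) = 0 by rewrite mulrC; exact/ger0_Im/mulcJ_ge0.
  by rewrite addr0 addrC.
have := h 1; have := h 'i; rewrite !rmorph1 !mul1r.
case: (tau a) => p q; case: (tau (star a)) => p' q' /=.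
rewrite !(mul0r, mul1r, addr0, add0r, mulN1r) => h1 h2.
by apply/eqP; rewrite eq_complex /=; apply/andP; split; apply/eqP; lra.
Qed.

Definition g2 a b : R := complex.Re (tau (a * star b)).

Lemma g2_semi_inner : semi_inner g2.
Proof.
split=> [a b|a b x|r a b|a]; rewrite /g2.
- by rewrite -{1}(starK a) -starM tau_star; case: (tau _).
- by rewrite mulrDl tauD raddfD.
- by rewrite -scalerAl tauZ; case: (tau _) => p q /=; rewrite mul0r subr0.
- by have := tau_ge0 a; rewrite lecE => /andP[].
Qed.

Let gP := g2_semi_inner.

Lemma g2_ge0 a : 0 <= g2 a a. Proof. exact: si_ge0. Qed.

Lemma tau_g2 a : tau (a * star a) = (g2 a a)%:C.
Proof. by rewrite /g2 RRe_real// ger0_real ?tau_ge0. Qed.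

Lemma g2_eq0 a : g2 a a = 0 -> a = 0.
Proof. by move=> h; apply: tau_faithful; rewrite tau_g2 h. Qed.

Lemma g2_star a b : g2 (star a) (star b) = g2 b a.
Proof. by rewrite /g2 starK tau_trace. Qed.

Lemma Re_tau_g2 a b : complex.Re (tau (a * b)) = g2 a (star b).
Proof. by rewrite /g2 starK. Qed.

Lemma Im_tau_g2 a b : complex.Im (tau (a * b)) = g2 a ('i *: star b).
Proof.
rewrite /g2 starZ starK -scalerAr tauZ; case: (tau _) => p q /=.
by rewrite !(mul0r, mulN1r, opprK, sub0r, add0r).
Qed.

Lemma norm2E a : norm2 a = Num.sqrt (g2 a a). Proof. by []. Qed.

Lemma norm2_sqr a : norm2 a ^+ 2 = g2 a a.
Proof. by rewrite norm2E sqr_sqrtr ?g2_ge0. Qed.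

Lemma norm2_lt a (e : R) : 0 < e -> (norm2 a < e) = (g2 a a < e ^+ 2).
Proof. by move=> e0; rewrite -norm2_sqr ltr_sqr ?nnegrE ?sqrtr_ge0 ?ltW. Qed.

(* Applied to star a * a, the ultraweak continuity of tau bounds the 2-norm by a
   vector norm in the amplified representation; this inequality is all that is
   needed from normality. *)
Lemma normality_domination : exists (zeta : l2 (Defs.space M)) (C : R), 0 <= C /\
  forall a, g2 a a <= C * l2ip (amp (rep a) zeta) (amp (rep a) zeta).
Proof.
have [p [xi [eta [d [xieta d0 h]]]]] := @tau_normal R M 1 ltr01.
have /choice[xi' xiE] (j : 'I_p) : exists u : l2 (Defs.space M), forall k, u k = xi j k.
  have /square_summable_sqsum/l2_predP yP := (xieta j).1.
  by exists (MkL2 yP).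
have /choice[eta' etaE] (j : 'I_p) : exists u : l2 (Defs.space M), forall k, u k = eta j k.
  have /square_summable_sqsum/l2_predP yP := (xieta j).2.
  by exists (MkL2 yP).
have [z1 hz1] := l2_merge_seq (enum 'I_p) xi'.
have [z2 hz2] := l2_merge_seq (enum 'I_p) eta'.
have [z hz] := l2_merge z1 z2.
have inE j : List.In j (enum 'I_p).
  have : j \in enum 'I_p by rewrite mem_enum.
  elim: (enum 'I_p) => //= i s IH; rewrite inE => /predU1P[->|/IH]; by [left|right].
pose N a := l2ip (amp (rep a) z) (amp (rep a) z).
(* Each form is at most the sum of the absolute values of its two real parts. By [l2ip_mean] each
   part is at most half the sum of two squared norms below [N a], so the total is at most
   [2 * N a < d]. *)
have small a : N a < d / 2 -> g2 a a < 1.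
  move=> Na; have ba := rep_bounded a.
  have : `|tau (star a * a)| < (1 : R)%:C.
    apply: h => j; rewrite /ultraweak_form.
    rewrite (_ : (fun k => _) = (fun k => inner (Defs.space M) (amp (rep a) (xi' j) k)
        (amp (rep a) (eta' j) k))); last first.
      by apply: funext => k; rewrite !ampE// xiE etaE repM rep_star starK.
    rewrite (cvg_lim _ (@l2_inner_cvg _ _ _ _))//.
    apply: le_lt_trans (normc_le_ReIm _) _; rewrite /= ltcR.
    have m1 := l2ip_mean (amp (rep a) (xi' j)) (amp (rep a) (eta' j)).
    have m2 := l2ip_mean (amp (rep a) (xi' j)) ('i *: amp (rep a) (eta' j)).
    rewrite l2ip_scale_i in m2.
    have n1 := hz1 _ _ ba (inE j); have n2 := hz2 _ _ ba (inE j).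
    have [n3 n4] := hz _ ba.
    by rewrite /N in Na; lra.
  rewrite tau_trace tau_g2 ger0_norm ?ler0c ?g2_ge0//.
  by rewrite ltcR.
exists z, (2 / d); split; first by rewrite divr_ge0// ltW.
move=> a; have [->|a0] := eqVneq (g2 a a) 0.
  by rewrite mulr_ge0 ?(si_ge0 (@l2ip_semi_inner _ _))// divr_ge0// ltW.
have ap : 0 < g2 a a by rewrite lt_neqAle eq_sym a0 g2_ge0.
(* Otherwise rescaling [a] to 2-norm 1 would bring [N a] below [d / 2]. *)
rewrite leNgt; apply/negP => lt.
pose r := (Num.sqrt (g2 a a))^-1.
have r2 : r ^+ 2 = (g2 a a)^-1 by rewrite exprVn sqr_sqrtr ?ltW.
have : N (r%:C *: a) < d / 2.
  rewrite /N (_ : amp _ _ = r%:C *: amp (rep a) z).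
    rewrite (si_scale (@l2ip_semi_inner _ _)) (si_scaler (@l2ip_semi_inner _ _)).
    rewrite mulrA -expr2 r2 mulrC ltr_pdivrMr// mulrC -ltr_pdivrMr ?divr_gt0//.
    by rewrite invf_div mulrC.
  apply: l2_ext => k; rewrite l2Z !ampE; try exact: rep_bounded.
  by have [_ -> _ _] := linear_props (rep_is_linear (z k)).
move=> /small; rewrite (si_scale gP) (si_scaler gP) mulrA -expr2 r2 mulVf//.
by rewrite ltxx.
Qed.

End TracialBasics.

(** * Boundedness of multiplication for the 2-norm *)

Lemma expn_bounded_le1 (R : realType) (q L : R) :
  0 <= q -> (forall n, q ^+ (2 ^ n) <= L) -> q <= 1.
Proof.
move=> q0 h; rewrite leNgt; apply/negP => q1.
have d0 : 0 < q - 1 by lra.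
have bern m : 1 + m%:R * (q - 1) <= q ^+ m.
  elim: m => [|m IH]; first by rewrite mul0r addr0 expr0.
  rewrite exprS -natr1; have m0 : (0 : R) <= m%:R by [].
  have := ler_wpM2l q0 IH; move: (m%:R) m0 (q ^+ m) => r r0 p h1.
  by have := mulr_ge0 r0 (sqr_ge0 (q - 1)); rewrite expr2 => h2; lra.
have L0 : 0 <= L by apply: le_trans (h 0); rewrite expn0 expr1.
pose n := Num.truncn (L / (q - 1)).
have := le_trans (bern _) (h n); have : (n.+1 <= 2 ^ n)%N by exact: ltn_expl.
rewrite -(ler_nat R); have := truncnS_gt (L / (q - 1)).
rewrite -/n ltr_pdivrMr//; move: (2 ^ n)%N => k h1 h2 h3; nra.
Qed.

Section MultiplicationBounded.
Context {R : realType} {M : tracialWType R}.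
Implicit Types (a b : M).

Let gP := @g2_semi_inner R M.
Local Notation N zeta a := (l2ip (amp (rep a) zeta) (amp (rep a) zeta)).

Lemma rep_bound a : exists2 C : R, 0 <= C &
  forall x : Defs.space M, rip (rep a x) (rep a x) <= C * rip x x.
Proof. exact/bounded_operatorP/rep_bounded. Qed.

(* Iterating the Cauchy-Schwarz inequality along the powers (star a * a)^(2^n)
   gives the operator norm bound without any functional calculus. *)
Lemma g2_mull_bound a : exists2 C : R, 0 <= C &
  forall b, g2 (a * b) (a * b) <= C * g2 b b.
Proof.
pose x := star a * a; have [zeta [K [K0 dom]]] := @normality_domination R M.
have [D' D'0 hD'] := rep_bound x.
(* Adding 1 makes [D] positive and also gives [D <= D ^+ 2], which is used at the very end. *)
pose D := D' + 1; have D0 : 0 < D by rewrite /D; lra.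
have hD (z : Defs.space M) : rip (rep x z) (rep x z) <= D * rip z z.
  apply: le_trans (hD' z) _; rewrite ler_wpM2r ?(si_ge0 rip_semi_inner)// /D; lra.
have hDm m b : N zeta (x ^+ m * b) <= D ^+ m * N zeta b.
  elim: m => [|m IH]; first by rewrite !expr0 !mul1r.
  rewrite exprS -mulrA.
  have -> : amp (rep (x * (x ^+ m * b))) zeta = amp (rep x) (amp (rep (x ^+ m * b)) zeta).
    by apply: l2_ext => k; rewrite !ampE ?repM//; exact: rep_bounded.
  apply: le_trans (amp_bound _ (rep_bounded x) hD (ltW D0)) _.
  by rewrite exprS -mulrA ler_wpM2l// ltW.
have starx m : star (x ^+ m) = x ^+ m.
  elim: m => [|m IH]; first by rewrite expr0 star1.
  by rewrite {1}exprSr starM IH /x starM starK -exprS.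
exists D; first exact: ltW.
move=> b; have [b0|b0] := eqVneq (g2 b b) 0.
  by rewrite (g2_eq0 b0) mulr0 !(si_0l gP) mulr0.
have bp : 0 < g2 b b by rewrite lt_neqAle eq_sym b0 g2_ge0.
(* As [x] is selfadjoint, [v n.+1] is the squared 2-norm of [x ^+ (2 ^ n) * b], and Cauchy-Schwarz
   bounds [v n ^+ 2] by [v n.+1 * g2 b b]. *)
pose v n := g2 (x ^+ (2 ^ n) * b) b.
have v0 : v 0 = g2 (a * b) (a * b).
  by rewrite /v expn0 expr1 /g2 /x -!mulrA tau_trace starM !mulrA.
have vS n : v n.+1 = g2 (x ^+ (2 ^ n) * b) (x ^+ (2 ^ n) * b).
  by rewrite /v /g2 starM starx expnS mul2n -addnn exprD -!mulrA tau_trace !mulrA.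
have vge n : 0 <= v n by case: n => [|n]; rewrite ?v0 ?vS g2_ge0.
have cs n : v n ^+ 2 <= v n.+1 * g2 b b by rewrite vS; exact: si_cauchy_schwarz.
have pw n : (v 0 / g2 b b) ^+ (2 ^ n) <= v n / g2 b b.
  elim: n => [|n IH]; first by rewrite expn0 expr1.
  rewrite expnSr exprM; apply: (@le_trans _ _ ((v n / g2 b b) ^+ 2)).
    rewrite ler_sqr ?nnegrE// ?exprn_ge0 ?divr_ge0//; exact: g2_ge0.
  rewrite expr_div_n ler_pdivrMr ?exprn_gt0//.
  by apply: le_trans (cs n) _; rewrite expr2 mulrA divfK.
(* Growth rates are compared: the factor [K * N zeta b / g2 b b] does not depend on [n], so bounding
   all powers [2 ^ n] by it forces the base to be at most 1. *)
have le1 : (v 0 / g2 b b) ^+ 2 / D <= 1.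
  apply: (@expn_bounded_le1 _ _ (K * N zeta b / g2 b b)).
    by rewrite divr_ge0 ?sqr_ge0// ltW.
  move=> n; rewrite expr_div_n -exprM -expnS ler_pdivrMr ?exprn_gt0//.
  apply: le_trans (pw n.+1) _; rewrite vS mulrAC ler_wpM2r ?invr_ge0 ?(ltW bp)//.
  apply: le_trans (dom _) _; rewrite -mulrA ler_wpM2l// mulrC.
  exact: hDm.
rewrite -v0 -ler_pdivrMr// -ler_sqr ?nnegrE ?divr_ge0 ?vge ?(ltW bp) ?(ltW D0)//.
move: le1; rewrite ler_pdivrMr// mul1r => /le_trans; apply.
by rewrite /D expr2; nra.
Qed.

Lemma g2_mulr_bound a : exists2 C : R, 0 <= C &
  forall b, g2 (b * a) (b * a) <= C * g2 b b.
Proof.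
have [C C0 hC] := g2_mull_bound (star a); exists C => // b.
by rewrite -g2_star starM -(g2_star b).
Qed.

End MultiplicationBounded.

(** * Commutants *)

Section Commutant.
Context {R : realType} {H : hilbertType R}.
Implicit Types (A B : set (H -> H)) (T S : H -> H).

Lemma bounded_id : @bounded_operator R H id.
Proof. by split=> // x. Qed.

Lemma bounded_comp T S : bounded_operator T -> bounded_operator S ->
  bounded_operator (T \o S).
Proof.
move=> [lT cT] [lS cS]; split=> [c x y|x]; first by rewrite /= lS lT.
by apply: continuous_comp; [exact: cS|exact: cT].
Qed.

Lemma bounded_comb c T S : bounded_operator T -> bounded_operator S ->
  bounded_operator (fun x => c *: T x + S x).
Proof.
move=> [lT cT] [lS cS]; split=> [d x y|x].
  by rewrite lT lS !scalerDr !scalerA (mulrC c) addrACA.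
apply: cvgD; last exact: cS.
by apply: cvgZr; exact: cT.
Qed.

Lemma commutant_id A : commutant A id.
Proof. by split; first exact: bounded_id. Qed.

Lemma commutant_comp A T S : commutant A T -> commutant A S -> commutant A (T \o S).
Proof.
move=> [bT hT] [bS hS]; split; first exact: bounded_comp.
move=> U AU; apply: funext => x /=.
have := congr1 (@^~ x) (hS U AU); have := congr1 (@^~ (S x)) (hT U AU).
by move=> /= e1 e2; rewrite e2 e1.
Qed.

Lemma commutant_comb A c T S : (forall U, A U -> bounded_operator U) ->
  commutant A T -> commutant A S -> commutant A (fun x => c *: T x + S x).
Proof.
move=> bA [bT hT] [bS hS]; split; first exact: bounded_comb.
move=> U AU; apply: funext => x /=; have [lU _] := bA U AU.
rewrite lU; have := congr1 (@^~ x) (hS U AU); have := congr1 (@^~ x) (hT U AU).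
by move=> /= e1 e2; rewrite e2 e1.
Qed.

Lemma commutantS A B : A `<=` B -> commutant B `<=` commutant A.
Proof. by move=> AB T [bT hT]; split=> // S /AB; exact: hT. Qed.

Lemma sub_bicommutant A : (forall T, A T -> bounded_operator T) ->
  A `<=` commutant (commutant A).
Proof. by move=> bA T AT; split=> [|S [_ hS]]; [exact: bA|rewrite hS]. Qed.

Lemma commutant3 A : (forall T, A T -> bounded_operator T) ->
  commutant (commutant (commutant A)) = commutant A.
Proof.
move=> bA; apply/seteqP; split; first exact/commutantS/sub_bicommutant.
by apply: sub_bicommutant => T [].
Qed.

End Commutant.

(** * Density of a star-subalgebra in the von Neumann algebra it generates *)

Section Density.
Context {R : realType} {M : tracialWType R}.
Implicit Types (a b : M) (S A : set M).

Let gP := @g2_semi_inner R M.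

Lemma subalgebraP A : unital_subalgebra A ->
  [/\ A 1, forall c a b, A a -> A b -> A (c *: a + b) &
      forall a b, A a -> A b -> A (a * b)].
Proof.
move=> [A1 Al Am]; split; first exact: set_mem A1.
  by move=> c a b /mem_set Aa /mem_set Ab; exact/set_mem/Al.
by move=> a b /mem_set Aa /mem_set Ab; exact/set_mem/Am.
Qed.

Lemma subalgebraI A : A 1 -> (forall c a b, A a -> A b -> A (c *: a + b)) ->
  (forall a b, A a -> A b -> A (a * b)) -> unital_subalgebra A.
Proof.
move=> A1 Al Am; split; first exact: mem_set.
  by move=> c a b /set_mem Aa /set_mem Ab; exact/mem_set/Al.
by move=> a b /set_mem Aa /set_mem Ab; exact/mem_set/Am.
Qed.

Variable A : set M.
Hypothesis AP : unital_star_subalgebra A.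

Let RA : set (Defs.space M -> Defs.space M) := [set rep a | a in A].

Let RA_bounded T : RA T -> bounded_operator T.
Proof. by move=> [a _ <-]; exact: rep_bounded. Qed.

Let bicomm : set M := [set a | commutant (commutant RA) (rep a)].

(** The bicommutant of [RA] lies in that of [range rep], which is [range rep] itself; hence all its
    elements come from M. *)
Let bicommE : [set rep a | a in bicomm] = commutant (commutant RA).
Proof.
apply/seteqP; split; first by move=> _ [a ha <-].
move=> T hT; have : range rep T.
  rewrite -(rep_bicommutant M); move: T hT; apply: commutantS.
  by apply: commutantS => _ [a _ <-]; exists a.
by move=> [a _ aT]; exists a => //; rewrite /bicomm /= aT.
Qed.

Let bicomm_vN : vN_subalgebra bicomm.
Proof.
have bc U : commutant RA U -> bounded_operator U by move=> [].
split; last by rewrite bicommE commutant3.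
split; first apply: subalgebraI.
- rewrite /bicomm /= (_ : rep 1 = id); last by apply: funext => x; rewrite rep1.
  exact: commutant_id.
- move=> c a b ha hb; rewrite /bicomm /=.
  rewrite (_ : rep _ = fun x => c *: rep a x + rep b x).
    exact: commutant_comb.
  by apply: funext => x; rewrite rep_linear.
- move=> a b ha hb; rewrite /bicomm /=.
  rewrite (_ : rep _ = rep a \o rep b); first exact: commutant_comp.
  by apply: funext => x; rewrite repM.
move=> a ha; split; first exact: rep_bounded.
move=> T hT; have [T' bT' adj] := adjoint_exists hT.1.
(* The commutant is stable under adjoints because [A] is stable under [star]. *)
have hT' : commutant RA T'.
  split=> // _ [s As <-]; apply: funext => x /=; apply: inner_inj => y.
  have := congr1 (fun f => f y) (hT.2 (rep (star s)) _).
  rewrite /= => e; rewrite -adj -(starK s) -!rep_adjoint -adj e//.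
  by exists (star s) => //; exact: AP.2.
apply: funext => x /=; apply: inner_inj => y; rewrite [LHS]innerC [RHS]innerC.
congr (_^*); rewrite -[a]starK in ha.
have := congr1 (fun f => f y) (ha.2 _ hT') => /= e.
rewrite starK in e.
by rewrite rep_star starK adj -e adj rep_star starK.
Qed.

(** Normality dominates the 2-norm by the norm at the single vector [zeta], so approximation at that
    vector, as the double commutant theorem gives it, is enough. *)
Lemma generated_vN_dense S : S `<=` A -> generated_vN S `<=` si_closure g2 A.
Proof.
move=> SA t /(_ bicomm) ht e e0.
have {ht} ht : bicomm t.
  apply: ht; split; first exact: bicomm_vN.
  by move=> s /SA As; apply: (sub_bicommutant RA_bounded); exists s.
have [zeta [K [K0 dom]]] := @normality_domination R M.
have [A1 Al Am] := subalgebraP AP.1.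
have K1 : 0 < K + 1 by lra.
have [|||||_ [a Aa <-] ha] := @bicommutant_approx _ _ RA RA_bounded _ _ _ _ zeta _ ht
    (e / (K + 1)).
- by exists 1 => //; apply: funext => x; rewrite rep1.
- move=> c _ _ [a Aa <-] [b Ab <-]; exists (c *: a + b); first exact: Al.
  by apply: funext => x; rewrite rep_linear.
- move=> _ _ [a Aa <-] [b Ab <-]; exists (a * b); first exact: Am.
  by apply: funext => x; rewrite repM.
- move=> _ [a Aa <-]; exists (rep (star a)); last exact: rep_adjoint.
  by exists (star a) => //; exact: AP.2.
- by rewrite divr_gt0.
exists a => //; apply: le_lt_trans (dom _) _.
rewrite (_ : amp _ _ = amp (rep t) zeta - amp (rep a) zeta); last first.
  by apply: l2_ext => k; rewrite l2D l2N !ampE ?repB//; exact: rep_bounded.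
move: ha; rewrite ltr_pdivlMr// => ha; apply: le_lt_trans ha.
rewrite mulrC ler_wpM2l ?(si_ge0 (@l2ip_semi_inner _ _))//; lra.
Qed.

End Density.

(** * Vectors of L^2 as Cauchy sequences *)

Section CauchySequences.
Context {R : realType} {M : tracialWType R}.
Implicit Types (a b : M) (u v : nat -> M) (A : set M).

Let gP := @g2_semi_inner R M.

Definition g2_null u := forall e : R, 0 < e ->
  exists K : nat, forall k, (K <= k)%N -> g2 (u k) (u k) < e.

Lemma L2_si_cauchy (S : set M) (J : L2 S) : si_cauchy g2 J.
Proof.
move=> e e0; have s0 : 0 < Num.sqrt e by rewrite sqrtr_gt0.
have [K hK] := L2_cauchy J s0; exists K => k l Kk Kl.
by have := hK k l Kk Kl; rewrite norm2_lt// sqr_sqrtr ?ltW.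
Qed.

Lemma si_cauchyD u v : si_cauchy g2 u -> si_cauchy g2 v -> si_cauchy g2 (u + v).
Proof.
move=> hu hv e e0; have e4 : 0 < e / 4 by lra.
have [K hK] := hu _ e4; have [L hL] := hv _ e4.
exists (maxn K L) => k l; rewrite !geq_max => /andP[Kk Lk] /andP[Kl Ll].
rewrite fctE opprD addrACA; apply: le_lt_trans (si_sqrD_le gP _ _) _.
by have := hK k l Kk Kl; have := hL k l Lk Ll; lra.
Qed.

Lemma si_cauchyN u : si_cauchy g2 u -> si_cauchy g2 (- u).
Proof.
move=> hu e e0; have [K hK] := hu _ e0; exists K => k l Kk Kl.
by rewrite /= -opprD (si_opp gP) (si_oppr gP) opprK hK.
Qed.

(** Here the boundedness of multiplication enters: products such as [J_i X_i] and [X_i J_i] are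
    again vectors of L^2. *)
Lemma si_cauchyM a b u : si_cauchy g2 u -> si_cauchy g2 (fun k => a * u k * b).
Proof.
move=> hu e e0; have [C C0 hC] := g2_mull_bound a.
have [D D0 hD] := g2_mulr_bound b.
have CD : 0 < D * C + 1 by rewrite ltr_wpDl// mulr_ge0.
have [K hK] := hu _ (divr_gt0 e0 CD); exists K => k l Kk Kl.
rewrite -mulrBl -mulrBr; apply: le_lt_trans (hD _) _.
have := hK k l Kk Kl; rewrite ltr_pdivlMr//; apply: le_lt_trans.
apply: le_trans (ler_wpM2l D0 (hC _)) _.
by rewrite mulrA mulrC ler_wpM2l ?g2_ge0//; lra.
Qed.

Lemma si_cauchy0 : si_cauchy g2 (0 : nat -> M).
Proof. by move=> e e0; exists 0 => k l _ _; rewrite subrr (si_0l gP). Qed.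

Lemma si_cauchy_sum (I : Type) (s : seq I) (F : I -> nat -> M) :
  (forall i, si_cauchy g2 (F i)) -> si_cauchy g2 (\sum_(i <- s) F i).
Proof.
move=> h; elim: s => [|i s IH]; first by rewrite big_nil; exact: si_cauchy0.
by rewrite big_cons; exact: si_cauchyD.
Qed.

Lemma g2_cauchy_cvg u b : si_cauchy g2 u -> cvgn (fun k => g2 (u k) b).
Proof.
move=> hu; apply/cauchy_cvgP; apply: cauchy_exP => e e0.
have b1 : 0 < g2 b b + 1 by rewrite ltr_wpDl// g2_ge0.
have [K hK] := hu _ (divr_gt0 (exprn_gt0 2 e0) b1).
exists (g2 (u K) b), K => // k /= Kk; rewrite -ball_normE /=.
rewrite -(si_opp gP) -(si_add gP) -ltr_sqr ?nnegrE ?(ltW e0)// real_normK ?num_real//.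
apply: le_lt_trans (si_cauchy_schwarz gP _ _) _.
have := hK K k (leqnn K) Kk; rewrite ltr_pdivlMr//; apply: le_lt_trans.
by rewrite ler_wpM2l ?g2_ge0//; lra.
Qed.

(** [L2_tau] for bare sequences, needed for approximants and for products of vectors with elements
    of M, which carry no [L2] structure. *)
Definition ltau u a : R[i] := limn (fun k => tau (u k * a) : R[i]^o).

Lemma ltau_cvg u a : si_cauchy g2 u ->
  (fun k => tau (u k * a) : R[i]^o) @ \oo --> (ltau u a : R[i]^o).
Proof.
move=> hu; rewrite /ltau.
have h : (fun k => tau (u k * a) : R[i]^o) @ \oo -->
    (Complex (limn (fun k => g2 (u k) (star a)))
             (limn (fun k => g2 (u k) ('i *: star a))) : R[i]^o).
  apply: cvg_complex.
    by under eq_fun do rewrite Re_tau_g2; exact: g2_cauchy_cvg.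
  by under eq_fun do rewrite Im_tau_g2; exact: g2_cauchy_cvg.
by move/cvgP: h.
Qed.

Lemma ltau_lim u a (z : R[i]) :
  (fun k => tau (u k * a) : R[i]^o) @ \oo --> (z : R[i]^o) -> ltau u a = z.
Proof. by move=> h; rewrite /ltau (cvg_lim _ h). Qed.

Lemma ltauD u a b : si_cauchy g2 u -> ltau u (a + b) = ltau u a + ltau u b.
Proof.
move=> hu; apply: ltau_lim; under eq_fun do rewrite mulrDr tauD.
by apply: cvgD; exact: ltau_cvg.
Qed.

Lemma ltauDl u v a : si_cauchy g2 u -> si_cauchy g2 v ->
  ltau (u + v) a = ltau u a + ltau v a.
Proof.
move=> hu hv; apply: ltau_lim; under eq_fun do rewrite fctE mulrDl tauD.
by apply: cvgD; exact: ltau_cvg.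
Qed.

Lemma ltauNl u a : si_cauchy g2 u -> ltau (- u) a = - ltau u a.
Proof.
move=> hu; apply: ltau_lim; under eq_fun do rewrite /= mulNr tauN.
by apply: cvgN; exact: ltau_cvg.
Qed.

Lemma ltau0l a : ltau 0 a = 0.
Proof. by apply: ltau_lim; under eq_fun do rewrite mul0r tau0; exact: cvg_cst. Qed.

Lemma ltau_suml (I : Type) (s : seq I) (F : I -> nat -> M) a :
  (forall i, si_cauchy g2 (F i)) ->
  ltau (\sum_(i <- s) F i) a = \sum_(i <- s) ltau (F i) a.
Proof.
move=> h; elim: s => [|i s IH]; first by rewrite !big_nil ltau0l.
by rewrite !big_cons ltauDl ?IH//; exact: si_cauchy_sum.
Qed.

Lemma ltauM u a b c : ltau (fun k => a * u k * b) c = ltau u (b * c * a).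
Proof.
have e : (fun k => tau (a * u k * b * c)) = (fun k => tau (u k * (b * c * a))).
  by apply: funext => k; rewrite -!mulrA tau_trace !mulrA.
by rewrite /ltau e.
Qed.

Lemma g2_cvg_ltau u a : si_cauchy g2 u ->
  (fun k => g2 (u k) a) @ \oo --> complex.Re (ltau u (star a)).
Proof.
move=> hu; have /cvg_Re := @ltau_cvg u (star a) hu.
by under eq_fun do rewrite Re_tau_g2 starK.
Qed.

Lemma ltau_null u a : g2_null u -> ltau u a = 0.
Proof.
move=> hu.
have nul b : (fun k => g2 (u k) b) @ \oo --> (0 : R).
  apply/cvgrPdist_lt => e e0.
  have b1 : 0 < g2 b b + 1 by rewrite ltr_wpDl// g2_ge0.
  have [K hK] := hu _ (divr_gt0 (exprn_gt0 2 e0) b1); exists K => // k /= Kk.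
  rewrite sub0r normrN -ltr_sqr ?nnegrE ?(ltW e0)// real_normK ?num_real//.
  apply: le_lt_trans (si_cauchy_schwarz gP _ _) _.
  have := hK k Kk; rewrite ltr_pdivlMr//; apply: le_lt_trans.
  by rewrite ler_wpM2l ?g2_ge0//; lra.
apply: ltau_lim; apply: cvg_complex.
  by under eq_fun do rewrite Re_tau_g2; exact: nul.
by under eq_fun do rewrite Im_tau_g2; exact: nul.
Qed.

Lemma ltau_eq u v a : si_cauchy g2 u -> si_cauchy g2 v -> g2_null (u - v) ->
  ltau u a = ltau v a.
Proof.
move=> hu hv /(@ltau_null _ a); rewrite ltauDl//; last exact: si_cauchyN.
by rewrite ltauNl// => /eqP; rewrite subr_eq0 => /eqP.
Qed.

Lemma si_cauchy_bounded u : si_cauchy g2 u -> exists (C : R) (K : nat),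
  0 < C /\ forall k, (K <= k)%N -> g2 (u k) (u k) <= C.
Proof.
move=> /(_ 1 ltr01)[K hK]; exists (2 + 2 * g2 (u K) (u K)), K; split.
  by have := g2_ge0 (u K); lra.
move=> k Kk; rewrite -{1 2}(subrK (u K) (u k)).
by apply: le_trans (si_sqrD_le gP _ _) _; have := hK k K Kk (leqnn K); lra.
Qed.

(** Since [v] is Cauchy, one fixed [a] in [A] is close to all its late terms; [u] is bounded and
    asymptotically orthogonal to that [a]. *)
Lemma g2_orth_cvg A u v : si_cauchy g2 u -> si_cauchy g2 v ->
  (forall k, si_closure g2 A (v k)) ->
  (forall a, A a -> (fun k => g2 (u k) a) @ \oo --> (0 : R)) ->
  (fun k => g2 (u k) (v k)) @ \oo --> (0 : R).
Proof.
move=> hu hv vA uA; apply/cvgrPdist_lt => e e0.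
have [C [K [C0 hC]]] := si_cauchy_bounded hu.
(* Chosen so that [C * (4 * d) = (e / 2) ^+ 2], where [4 * d] bounds the squared distance from [v k]
   to [a]. *)
pose d := (e / 2) ^+ 2 / C / 4.
have e2 : 0 < e / 2 by lra.
have d0 : 0 < d by rewrite !divr_gt0// exprn_gt0.
have [L hL] := hv _ d0; have [a Aa ha] := vA L _ d0.
have /cvgrPdist_lt/(_ _ e2)[N _ hN] := uA a Aa.
exists (maxn K (maxn L N)) => // k /=; rewrite !geq_max => /and3P[Kk Lk Nk].
rewrite sub0r normrN.
have -> : g2 (u k) (v k) = g2 (u k) (v k - a) + g2 (u k) a.
  by rewrite (si_addr gP) (si_oppr gP) subrK.
apply: le_lt_trans (ler_normD _ _) _; rewrite (splitr e).
apply: ler_ltD; last by have := hN k Nk; rewrite /= sub0r normrN.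
rewrite -ler_sqr ?nnegrE ?(ltW e2)// real_normK ?num_real//.
apply: le_trans (si_cauchy_schwarz gP _ _) _.
have h1 : g2 (v k - a) (v k - a) <= 4 * d.
  by apply: le_trans (si_sqrB_le gP _ (v L) _) _; have := hL k L Lk (leqnn L); lra.
apply: le_trans (ler_pM _ _ (hC k Kk) h1) _; rewrite ?g2_ge0//.
rewrite /d mulrC -!mulrA (mulrC 4^-1) !mulrA.
have C1 : C != 0 by rewrite gt_eqF.
by rewrite le_eqVlt; apply/orP; left; apply/eqP; field.
Qed.

(** A vector in the closure of [A] that is orthogonal to [A] is orthogonal to itself. *)
Lemma g2_null_orth A u : si_cauchy g2 u -> (forall k, si_closure g2 A (u k)) ->
  (forall a, A a -> ltau u (star a) = 0) -> g2_null u.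
Proof.
move=> hu uA h e e0.
have /cvgrPdist_lt/(_ _ e0)[K _ hK] : (fun k => g2 (u k) (u k)) @ \oo --> (0 : R).
  apply: (g2_orth_cvg hu hu uA) => a Aa.
  by have := @g2_cvg_ltau u a hu; rewrite h.
exists K => k Kk; have := hK k Kk; rewrite /= sub0r normrN ger0_norm//.
exact: g2_ge0.
Qed.

Lemma norm2D a b : norm2 (a + b) <= norm2 a + norm2 b.
Proof.
rewrite -ler_sqr ?nnegrE ?addr_ge0 ?sqrtr_ge0// sqrrD !norm2_sqr.
rewrite (si_add gP) !(si_addr gP) (si_sym gP b a).
have : g2 a b <= norm2 a * norm2 b.
  apply: le_trans (ler_norm _) _.
  rewrite -ler_sqr ?nnegrE ?mulr_ge0 ?sqrtr_ge0// real_normK ?num_real//.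
  by rewrite exprMn !norm2_sqr si_cauchy_schwarz.
by rewrite mulr2n; lra.
Qed.

Lemma norm2_cvg u : si_cauchy g2 u -> cvgn (fun k => norm2 (u k)).
Proof.
move=> hu; apply/cauchy_cvgP; apply: cauchy_exP => e e0.
have [K hK] := hu _ (exprn_gt0 2 e0).
exists (norm2 (u K)), K => // k /= Kk; rewrite -ball_normE /=.
have h a b : norm2 a - norm2 b <= norm2 (a - b).
  by rewrite lerBlDr -{1}(subrK b a) norm2D.
have h1 := hK K k (leqnn K) Kk; have h2 := hK k K Kk (leqnn K).
rewrite -norm2_lt// in h1; rewrite -norm2_lt// in h2.
rewrite ltr_norml; have := h (u K) (u k); have := h (u k) (u K).
by move=> h3 h4; apply/andP; split; lra.
Qed.

Lemma L2_norm_cvg (S : set M) (J : L2 S) :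
  (fun k => g2 (J k) (J k)) @ \oo --> L2_norm J ^+ 2.
Proof.
have h : (fun k => norm2 (J k)) @ \oo --> L2_norm J by exact/norm2_cvg/L2_si_cauchy.
under eq_fun do rewrite -norm2_sqr expr2; rewrite expr2.
exact: (cvgM h h).
Qed.

Lemma approx_seq A u : (forall k, si_closure g2 A (u k)) ->
  exists2 a : nat -> M, (forall k, A (a k)) & g2_null (u - a).
Proof.
move=> uA; have /choice[a ha] k : exists a, A a /\ g2 (u k - a) (u k - a) < k.+1%:R^-1.
  by have [|a Aa ka] := uA k k.+1%:R^-1; [rewrite invr_gt0|exists a].
exists a => [k|e e0]; first by case: (ha k).
have [K hK] := natSinv_lt e0; exists K => k Kk.
by apply: lt_trans (hK k Kk); case: (ha k).
Qed.

Lemma si_cauchy_null u v : si_cauchy g2 u -> g2_null (u - v) -> si_cauchy g2 v.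
Proof.
move=> hu h e e0; have e16 : 0 < e / 16 by lra.
have [K hK] := hu _ e16; have [L hL] := h _ e16.
exists (maxn K L) => k l; rewrite !geq_max => /andP[Kk Lk] /andP[Kl Ll].
apply: le_lt_trans (si_sqrB_le gP _ (u k) _) _; rewrite (si_sqrBC gP).
have := si_sqrB_le gP (u k) (u l) (v l).
have := hK k l Kk Kl; have := hL k Lk; have := hL l Ll; rewrite !fctE /=; lra.
Qed.

End CauchySequences.

(** * Generated algebras *)

Section GeneratedAlgebra.
Context {R : realType} {M : tracialWType R}.
Implicit Types (a b : M) (S A K : set M).

Lemma generated_algebraP S : unital_subalgebra (generated_algebra S).
Proof.
apply: subalgebraI.
- by move=> A [/subalgebraP[]].
- move=> c a b ha hb A [AP SA]; have [_ Al _] := subalgebraP AP.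
  by apply: Al; [exact: ha|exact: hb].
- move=> a b ha hb A [AP SA]; have [_ _ Am] := subalgebraP AP.
  by apply: Am; [exact: ha|exact: hb].
Qed.

Lemma subalgebra_subspace A : unital_subalgebra A -> real_subspace A.
Proof.
move=> /subalgebraP[A1 Al _]; split; last first.
  by move=> r x y Ax Ay; rewrite addrC; exact: Al.
by rewrite -(subrr (1 : M)) addrC -scaleN1r; exact: Al.
Qed.

Lemma sub_generated_algebra S : S `<=` generated_algebra S.
Proof. by move=> a Sa A [_ SA]; exact: SA. Qed.

Lemma generated_algebra_star S : (forall a, S a -> S (star a)) ->
  unital_star_subalgebra (generated_algebra S).
Proof.
move=> Sstar; split; first exact: generated_algebraP.
have [G1 Gl Gm] := subalgebraP (generated_algebraP S).
move=> a /(_ [set a | generated_algebra S (star a)]); apply; split.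
  apply: subalgebraI => /=.
  - by rewrite star1.
  - by move=> c x y hx hy; rewrite starZD; exact: Gl.
  - by move=> x y hx hy; rewrite starM; exact: Gm.
by move=> x Sx; exact: (sub_generated_algebra (Sstar _ Sx)).
Qed.

Lemma generated_algebra_sub S A : unital_subalgebra A -> S `<=` A ->
  generated_algebra S `<=` A.
Proof. by move=> AP SA a /(_ A); apply. Qed.

Lemma generated_algebra_vN S : generated_algebra S `<=` generated_vN S.
Proof.
move=> a ha N [NP SN]; apply: ha; split=> //; exact: NP.1.1.
Qed.

Lemma L2_dense (n : nat) (X : 'I_n -> M) K : (forall i, star (X i) = X i) ->
  unital_star_subalgebra K -> forall (J : L2 (range X `|` K)) k,
  si_closure g2 (generated_algebra (range X `|` K)) (J k).
Proof.
move=> Xs KP J k; apply: (@generated_vN_dense _ _ _ _ (range X `|` K)).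
- apply: generated_algebra_star => a [[i _ <-]|Ka]; first by left; rewrite Xs; exists i.
  by right; exact: KP.2.
- exact: sub_generated_algebra.
- exact: L2_mem.
Qed.

End GeneratedAlgebra.

(** * Free difference quotients and conjugate variables *)

Section FreeDifferenceQuotient.
Context {R : realType} {M : tracialWType R} {n : nat} (X : 'I_n -> M).
Implicit Types (u v w : M) (K : set M) (T U : seq ('I_n * M * M)).

(* [free_diff K w T]: some expression of w as a polynomial in X with coefficients
   in K has its free difference quotients given by T, an entry (i, x, y)
   standing for the summand x (x) y of the i-th one. *)
Inductive free_diff K : M -> seq ('I_n * M * M) -> Prop :=
| DiffConst b : K b -> free_diff K b [::]
| DiffVar j : free_diff K (X j) [:: (j, 1, 1)]
| DiffAdd u T v U : free_diff K u T -> free_diff K v U -> free_diff K (u + v) (T ++ U)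
| DiffMul u T v U : free_diff K u T -> free_diff K v U ->
  free_diff K (u * v)
    ([seq (t.1.1, t.1.2, t.2 * v) | t <- T] ++ [seq (t.1.1, u * t.1.2, t.2) | t <- U]).

Lemma free_diff_mono K K' w T : K `<=` K' -> free_diff K w T -> free_diff K' w T.
Proof.
by move=> KK'; elim=> *; [apply: DiffConst; exact: KK'|exact: DiffVar|
  exact: DiffAdd|exact: DiffMul].
Qed.

Lemma free_diff_exists K w : unital_subalgebra K ->
  generated_algebra (range X `|` K) w -> exists T, free_diff K w T.
Proof.
move=> KP; have [K1 Kl Km] := subalgebraP KP.
move=> /(_ [set w | exists T, free_diff K w T]); apply; split.
  apply: subalgebraI => /=.
  - by exists [::]; exact: DiffConst.
  - move=> c u v [T hT] [U hU].
    have K0 : K 0 by rewrite -(subrr (1 : M)) addrC -scaleN1r; exact: Kl.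
    have Kc : K (c *: 1) by rewrite -[c *: 1]addr0; exact: Kl.
    have := DiffAdd (DiffMul (DiffConst Kc) hT) hU.
    by rewrite -scalerAl mul1r => h; eexists; exact: h.
  - by move=> u v [T hT] [U hU]; eexists; exact: (DiffMul hT hU).
move=> a [[j _ <-]|Ka]; first by exists [:: (j, 1, 1)]; exact: DiffVar.
by exists [::]; exact: DiffConst.
Qed.

Lemma free_diff_mem K w T : unital_subalgebra K -> free_diff K w T ->
  {in T, forall t, generated_algebra (range X `|` K) t.1.2 /\
                           generated_algebra (range X `|` K) t.2}.
Proof.
move=> KP; have [G1 Gl Gm] := subalgebraP (generated_algebraP (range X `|` K)).
have mem v U : free_diff K v U -> generated_algebra (range X `|` K) v.
  elim=> [b Kb|j|{}v {}U v' U' _ hv _ hv'|{}v {}U v' U' _ hv _ hv'].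
  - by apply: sub_generated_algebra; right.
  - by apply: sub_generated_algebra; left; exists j.
  - by rewrite -[v]scale1r; exact: Gl.
  - exact: Gm.
elim=> [//|j t|u {}T v U _ hu _ hv t|u {}T v U du hu dv hv t].
- by rewrite inE => /eqP ->.
- by rewrite mem_cat => /orP[/hu|/hv].
rewrite mem_cat => /orP[] /mapP[t' + ->] /=.
  by move=> /hu[h1 h2]; split=> //; apply: Gm => //; exact: mem dv.
by move=> /hv[h1 h2]; split=> //; apply: Gm => //; exact: mem du.
Qed.

(** The value of tau (x) tau on the [i]-th free difference quotient. *)
Definition diff_tau (i : 'I_n) (T : seq ('I_n * M * M)) : R[i] :=
  \sum_(t <- T) (i == t.1.1)%:R * (tau t.1.2 * tau t.2).

Section Words.
Variables (K : set M) (i : 'I_n).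
Hypothesis KP : unital_subalgebra K.

(* Products of letters, listed from right to left. *)
Fixpoint monomial (l : seq ('I_n + M)) : M :=
  match l with
  | [::] => 1
  | inl j :: l' => monomial l' * X j
  | inr b :: l' => monomial l' * b
  end.

Fixpoint letters (l : seq ('I_n + M)) : Prop :=
  match l with
  | [::] => True
  | inl _ :: l' => letters l'
  | inr b :: l' => K b /\ letters l'
  end.

(** The value of tau (x) tau on the [i]-th free difference quotient of [monomial l], with every
    right leg multiplied on the right by [z]. *)
Fixpoint monomial_diff (l : seq ('I_n + M)) (z : M) : R[i] :=
  match l with
  | [::] => 0
  | inl j :: l' =>
      monomial_diff l' (X j * z) + (i == j)%:R * (tau (monomial l') * tau z)
  | inr b :: l' => monomial_diff l' (b * z)
  end.

Lemma monomial_diffD l y z :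
  monomial_diff l (y + z) = monomial_diff l y + monomial_diff l z.
Proof.
elim: l y z => [|[j|b] l IH] y z /=; first by rewrite addr0.
  by rewrite mulrDr IH tauD !mulrDr addrACA.
by rewrite mulrDr IH.
Qed.

Lemma word_ext (b b' : nat -> M) (s s' : nat -> 'I_n) p q :
  (forall k, (k <= q)%N -> b k = b' k) -> (forall k, (k < q)%N -> s k = s' k) ->
  word X b s p q = word X b' s' p q.
Proof.
move=> hb hs; rewrite /word hb//; congr (_ * _).
by apply: eq_big_nat => k /andP[_ kq]; rewrite hb ?hs// ltnW.
Qed.

Lemma monomial_word l : letters l -> exists (m : nat) (b : nat -> M) (s : nat -> 'I_n),
  [/\ forall k, K (b k), monomial l = word X b s 0 m &
      forall z, monomial_diff l z = \sum_(r < m) (i == s r)%:R *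
        (tau (word X b s 0 r) * tau (word X b s r.+1 m * z))].
Proof.
have [K1 _ Km] := subalgebraP KP.
elim: l => [_|[j|c] l IH /=].
- exists 0%N, (fun _ => 1), (fun _ => i); split=> //=.
    by rewrite /word big_nil mul1r.
  by move=> z; rewrite big_ord0.
- move=> /IH[m [b [s [Kb e h]]]].
  (* The new variable closes the word, so a coefficient 1 is appended after it. *)
  pose b' k := if k == m.+1 then 1 else b k; pose s' k := if k == m then j else s k.
  have b'E k : (k <= m)%N -> b' k = b k.
    by rewrite /b' -ltnS => /ltn_eqF ->.
  have s'E k : (k < m)%N -> s' k = s k by rewrite /s' => /ltn_eqF ->.
  have bm : b' m.+1 = 1 by rewrite /b' eqxx.
  have sm : s' m = j by rewrite /s' eqxx.
  have wS p : (p <= m)%N -> word X b' s' p m.+1 = word X b s p m * X j.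
    move=> pm; rewrite /word big_nat_recr//= (b'E m)// sm bm mulr1 mulrA.
    congr (_ * _ * _).
    by apply: eq_big_nat => k /andP[_ kq]; rewrite b'E ?s'E// ltnW.
  exists m.+1, b', s'; split=> [k||z].
  + by rewrite /b'; case: ifP.
  + by rewrite wS// e.
  + rewrite h big_ord_recr /=; congr (_ + _).
      apply: eq_bigr => r _; rewrite wS// s'E// -mulrA.
      rewrite (@word_ext b' b s' s 0 r)// => k kr; [apply: b'E|apply: s'E];
        by [apply: leq_trans kr (ltnW _)|apply: ltn_trans kr _].
    rewrite sm e (@word_ext b' b s' s 0 m)//.
    have -> : word X b' s' m.+1 m.+1 = 1 by rewrite /word big_geq// mul1r.
    by rewrite mul1r.
- move=> [Kc /IH[m [b [s [Kb e h]]]]].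
  (* A new coefficient is absorbed into the last coefficient of the word. *)
  pose b' k := if k == m then b k * c else b k.
  have b'E k : (k < m)%N -> b' k = b k by rewrite /b' => /ltn_eqF ->.
  have wm p : (p <= m)%N -> word X b' s p m = word X b s p m * c.
    move=> pm; rewrite /word (_ : b' m = b m * c) ?mulrA; last by rewrite /b' eqxx.
     congr (_ * _ * _).
    by apply: eq_big_nat => k /andP[_ kq]; rewrite b'E.
  exists m, b', s; split=> [k||z].
  + by rewrite /b'; case: ifP => // _; exact: Km.
  + by rewrite wm// e.
  + rewrite h; apply: eq_bigr => r _; rewrite wm// -mulrA.
    rewrite (@word_ext b' b s s 0 r)// => k kr.
    by apply: b'E; apply: leq_ltn_trans kr _.
Qed.

Variable F : M -> R[i].
Hypothesis F_add : forall u v, F (u + v) = F u + F v.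
Hypothesis F_word : forall m (b : nat -> M) (s : nat -> 'I_n),
  (forall k, K (b k)) -> F (word X b s 0 m) =
  \sum_(r < m) (i == s r)%:R * (tau (word X b s 0 r) * tau (word X b s r.+1 m)).

(** [Phi p] stands for the share of the derivative of [p * v] in which a variable of [v] is
    differentiated. This form lets the right context grow while the relation is only known for
    words. *)
Let good v (Phi : M -> R[i]) := (forall p q, Phi (p + q) = Phi p + Phi q) /\
  forall l, letters l -> F (monomial l * v) = monomial_diff l v + Phi (monomial l).

Let good1 : good 1 (fun _ => 0).
Proof.
split=> [p q|l /monomial_word[m [b [s [Kb e h]]]]]; first by rewrite addr0.
rewrite mulr1 addr0 h e F_word//.
by apply: eq_bigr => r _; rewrite mulr1.
Qed.

(* Peeling the letters of w off to the left, with an arbitrary right context. *)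
Let good_mul w T : free_diff K w T -> forall v Phi, good v Phi -> good (w * v)
  (fun p => \sum_(t <- T) (i == t.1.1)%:R * (tau (p * t.1.2) * tau (t.2 * v)) + Phi (p * w)).
Proof.
elim=> [b Kb v Phi [PhiD h]|j v Phi [PhiD h]|w1 T1 w2 T2 _ IH1 _ IH2 v Phi hv|
  w1 T1 w2 T2 _ IH1 _ IH2 v Phi hv].
- split=> [p q|l Kl]; first by rewrite !big_nil !add0r mulrDl PhiD.
  by have := h (inr b :: l) (conj Kb Kl); rewrite /= big_nil add0r mulrA.
- split=> [p q|l Kl].
    by rewrite !big_seq1 /= !mulr1 mulrDl PhiD tauD mulrDl mulrDr addrACA.
  by have /= e := h (inl j :: l) Kl; rewrite mulrA e big_seq1 /= mulr1 mul1r addrA.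
- have [D1 h1] := IH1 _ _ hv; have [D2 h2] := IH2 _ _ hv; have [PhiD h] := hv.
  split=> [p q|l Kl].
    rewrite !big_cat /= mulrDl PhiD.
    have := D1 p q; have := D2 p q; rewrite !mulrDl !PhiD => e2 e1.
    rewrite !mulrDr !PhiD.
    move: e1 e2; set s1 := \sum_(t <- T1) _; set s2 := \sum_(t <- T2) _.
    set s1p := \sum_(t <- T1) _; set s1q := \sum_(t <- T1) _.
    set s2p := \sum_(t <- T2) _; set s2q := \sum_(t <- T2) _.
    move=> e1 e2; have {}e1 : s1 = s1p + s1q.
      apply: (addIr (Phi (p * w1) + Phi (q * w1))); rewrite e1; ring.
    have {}e2 : s2 = s2p + s2q.
      apply: (addIr (Phi (p * w2) + Phi (q * w2))); rewrite e2; ring.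
    rewrite e1 e2; ring.
  rewrite mulrDl mulrDr F_add h1// h2// monomial_diffD big_cat /= mulrDr PhiD; ring.
- have h2 := IH2 _ _ hv; have [D1 h1] := IH1 _ _ h2; have [PhiD h] := hv.
  have eq p : \sum_(t <- [seq (t.1.1, t.1.2, t.2 * w2) | t <- T1] ++
      [seq (t.1.1, w1 * t.1.2, t.2) | t <- T2])
      (i == t.1.1)%:R * (tau (p * t.1.2) * tau (t.2 * v)) + Phi (p * (w1 * w2)) =
    \sum_(t <- T1) (i == t.1.1)%:R * (tau (p * t.1.2) * tau (t.2 * (w2 * v))) +
      (\sum_(t <- T2) (i == t.1.1)%:R * (tau (p * w1 * t.1.2) * tau (t.2 * v)) +
       Phi (p * w1 * w2)).
    rewrite big_cat !big_map /= addrA mulrA; congr (_ + _ + _).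
      by apply: eq_bigr => t _; rewrite (mulrA t.2).
    by apply: eq_bigr => t _; rewrite (mulrA p).
  split=> [p q|l Kl]; first by rewrite !eq D1.
  by rewrite eq -mulrA h1.
Qed.

(** In particular [diff_tau i T] is the same for all expressions [T] of [w], even if the quotient
    itself depends on the expression. *)
Lemma free_diff_word w T : free_diff K w T -> F w = diff_tau i T.
Proof.
move=> hT; have [_ /(_ [::] I)] := good_mul hT good1.
rewrite /= !mul1r mulr1 addr0 add0r => ->.
by apply: eq_bigr => t _; rewrite mul1r mulr1.
Qed.

End Words.

Lemma conjugate_diff K (J : 'I_n -> L2 (range X `|` K)) i w T :
  unital_subalgebra K -> conjugate_variables J -> free_diff K w T ->
  ltau (J i) w = diff_tau i T.
Proof.
move=> KP hJ; apply: free_diff_word => //.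
  by move=> u v; apply: ltauD; exact: L2_si_cauchy.
by move=> m b s Kb; exact: hJ.
Qed.

End FreeDifferenceQuotient.

(** * Conditional expectations onto finite-dimensional algebras *)

Section ConditionalExpectation.
Context {R : realType} {M : tracialWType R}.
Variables (D : set M) (E : M -> M).
Hypothesis DP : unital_star_subalgebra D.
Hypothesis EP : conditional_expectation D E.
Hypothesis tauE : forall a, tau (E a) = tau a.
Implicit Types (a b d : M).

Let EL : linear E. Proof. by case: EP. Qed.
Let D1 : D 1. Proof. by have [] := subalgebraP DP.1. Qed.
Let Dl c a b : D a -> D b -> D (c *: a + b).
Proof. by have [_ h _] := subalgebraP DP.1; exact: h. Qed.
Let Ds a : D a -> D (star a). Proof. exact: DP.2. Qed.
Let D0 : D 0.
Proof. by rewrite -(subrr (1 : M)) addrC -scaleN1r; exact: Dl. Qed.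
Let DZ c a : D a -> D (c *: a).
Proof. by move=> Da; rewrite -[c *: a]addr0; exact: Dl. Qed.
Let DB a b : D a -> D b -> D (a - b).
Proof. by move=> Da Db; rewrite addrC -scaleN1r; exact: Dl. Qed.

Lemma cexp_mem a : D (E a). Proof. by case: EP. Qed.
Lemma cexp1 : E 1 = 1. Proof. by case: EP. Qed.
Lemma cexpD a b : E (a + b) = E a + E b.
Proof. by have [_ _ -> _] := linear_props EL. Qed.
Lemma cexpB a b : E (a - b) = E a - E b.
Proof. by have [_ _ _ ->] := linear_props EL. Qed.

Lemma cexpMl d a : D d -> E (d * a) = d * E a.
Proof. by case: EP => _ _ _ h Dd; have := h d 1 a Dd D1; rewrite !mulr1. Qed.

Lemma cexpMr d a : D d -> E (a * d) = E a * d.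
Proof. by case: EP => _ _ _ h Dd; have := h 1 d a D1 Dd; rewrite !mul1r. Qed.

Lemma cexp_id d : D d -> E d = d.
Proof. by move=> Dd; rewrite -[d in E d]mulr1 cexpMl// cexp1 mulr1. Qed.

Lemma cexp_center a : E (a - E a) = 0.
Proof. by rewrite cexpB (cexp_id (cexp_mem a)) subrr. Qed.

Lemma tau_cexpMl a b : tau (E a * b) = tau (E a * E b).
Proof. by rewrite -tauE cexpMl//; exact: cexp_mem. Qed.

Lemma tau_cexpMr a b : tau (a * E b) = tau (E a * E b).
Proof. by rewrite -tauE cexpMr//; exact: cexp_mem. Qed.

Lemma cexp_eq0 a : (forall d, D d -> tau (d * a) = 0) -> E a = 0.
Proof.
move=> h; apply: tau_faithful; rewrite tau_trace.
have Ds' : D (star (E a)) by exact/Ds/cexp_mem.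
by rewrite -cexpMl// tauE h.
Qed.

(** [E a] is determined in [D] by [tau (d * E a) = tau (d * a)] for all [d] in [D], a condition that
    is stable under adjoints. *)
Lemma cexp_star a : E (star a) = star (E a).
Proof.
have Da := cexp_mem a; have Dsa := cexp_mem (star a).
have Dz : D (E (star a) - star (E a)) by apply: DB => //; exact: Ds.
apply/eqP; rewrite -subr_eq0 -(cexp_id Dz); apply/eqP/cexp_eq0 => d Dd.
rewrite mulrBr tauB -cexpMl// tauE.
have -> : tau (d * star a) = (tau (a * star d))^* by rewrite -tau_star starM starK.
have -> : tau (d * star (E a)) = (tau (E a * star d))^* by rewrite -tau_star starM starK.
by rewrite -(cexpMr a (Ds Dd)) tauE subrr.
Qed.

Local Notation P us x := (\sum_(p <- us) (p.1 * tau (x * star p.2)) *: p.2).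

Let P_lin (us : seq (R[i] * M)) c x y : P us (c *: x + y) = c *: P us x + P us y.
Proof.
elim: us => [|p us IH]; first by rewrite !big_nil scaler0 addr0.
rewrite !big_cons IH mulrDl tauD -scalerAl tauZ mulrDr scalerDl scalerDr scalerA.
by rewrite addrACA mulrCA.
Qed.

Let P_sum (us vs : seq (R[i] * M)) (f : R[i] * M -> R[i]) :
  {in vs, forall p, P us p.2 = p.2} ->
  P us (\sum_(p <- vs) f p *: p.2) = \sum_(p <- vs) f p *: p.2.
Proof.
elim: vs => [|p vs IH] h.
  by rewrite big_nil big1// => p _; rewrite mul0r tau0 mulr0 scale0r.
rewrite big_cons P_lin h ?mem_head// IH// => q qvs.
by apply: h; rewrite inE qvs orbT.
Qed.

Let P_adj (us : seq (R[i] * M)) x y : {in us, forall p, (p.1)^* = p.1} ->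
  tau (P us x * star y) = tau (x * star (P us y)).
Proof.
elim: us => [|p us IH] h; first by rewrite !big_nil star0 mul0r mulr0.
rewrite !big_cons mulrDl starD mulrDr !tauD IH => [|q qus]; last first.
  by apply: h; rewrite inE qus orbT.
congr (_ + _); rewrite starZ -scalerAl -scalerAr !tauZ rmorphM /= h ?mem_head//.
have -> : (tau (y * star p.2))^* = tau (p.2 * star y) by rewrite -tau_star starM starK.
ring.
Qed.

Let P_mem (us : seq (R[i] * M)) x : {in us, forall p, D p.2} -> D (P us x).
Proof.
elim: us => [|p us IH] h; first by rewrite big_nil.
rewrite big_cons; apply: Dl; first by apply: h; rewrite mem_head.
by apply: IH => q qus; apply: h; rewrite inE qus orbT.
Qed.

(* Gram-Schmidt, with weights instead of normalised vectors. *)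
Let orthogonal_projection (s : seq M) : {in s, forall a, D a} ->
  exists us : seq (R[i] * M), [/\ {in us, forall p, D p.2},
    {in us, forall p, (p.1)^* = p.1}, {in us, forall p, P us p.2 = p.2}
    & {in s, forall a, P us a = a}].
Proof.
elim: s => [_|e s IH Des]; first by exists [::].
have [|us [usD usR usP usS]] := IH; first by move=> a sa; apply: Des; rewrite inE sa orbT.
have PP x : P us (P us x) = P us x by exact: P_sum.
pose r := e - P us e.
have De : D e by apply: Des; rewrite mem_head.
have Dr : D r by apply: DB => //; exact: P_mem.
have orth a : P us a = a -> tau (a * star r) = 0.
  move=> Pa; rewrite /r starB mulrBr tauB -P_adj// Pa subrr//.
have [r0|r0] := eqVneq (g2 r r) 0.
  (* [e] already lies in the span, by faithfulness of [tau]; nothing is added. *)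
  exists us; split=> // a; rewrite inE => /predU1P[->|]; last exact: usS.
  by move/g2_eq0 : r0 => /eqP; rewrite subr_eq0 => /eqP.
pose c : R[i] := ((g2 r r)^-1)%:C.
have cr : c * tau (r * star r) = 1 by rewrite tau_g2 /c -rmorphM mulVf.
have Pr : P us r = 0.
  have -> : r = (-1) *: P us e + e by rewrite scaleN1r addrC.
  by rewrite P_lin PP scaleN1r addNr.
exists ((c, r) :: us); split.
- by move=> p; rewrite inE => /predU1P[->//|]; exact: usD.
- move=> p; rewrite inE => /predU1P[->|]; last exact: usR.
  by rewrite /= /c; exact: conjc_real.
- move=> p; rewrite inE big_cons /= => /predU1P[->/=|hp].
    by rewrite cr scale1r Pr addr0.
  by rewrite orth ?mulr0 ?scale0r ?add0r ?usP.
move=> a; rewrite inE big_cons /= => /predU1P[->|hs].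
  have -> : tau (e * star r) = tau (r * star r).
    by rewrite -[in LHS](subrK (P us e) e) -/r mulrDl tauD (orth (P us e)) ?addr0 ?PP.
  by rewrite cr scale1r /r subrK.
by rewrite orth ?mulr0 ?scale0r ?add0r ?usS.
Qed.

(** [E] is the orthogonal projection onto [D], hence equals the Gram-Schmidt projection. The second
    formula is the adjoint of the first. Together they let one leg of [Omega] be contracted by [tau]
    from either side. *)
Lemma dual_basis_exists : finite_dimensional D -> exists bs : seq (M * M),
  [/\ {in bs, forall p, D p.1 /\ D p.2},
      forall x, \sum_(p <- bs) tau (x * p.1) *: p.2 = E x
    & forall x, \sum_(p <- bs) tau (p.2 * x) *: p.1 = E x].
Proof.
move=> [k [e [De spanD]]].
have [|us [usD usR usP usS]] := @orthogonal_projection [seq e i | i <- enum 'I_k].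
  by move=> _ /mapP[i _ ->].
have PE x : P us x = E x.
  have -> : P us x = P us (E x).
    apply: eq_big_seq => p hp; congr (_ * _ *: _).
    by rewrite -(cexpMr x (Ds (usD p hp))) ?tauE// -tauE cexpMr//; exact/Ds/usD.
  have [c ->] := spanD _ (cexp_mem x).
  elim: (index_enum _) => [|i l IH].
    by rewrite !big_nil big1// => p _; rewrite mul0r tau0 mulr0 scale0r.
  by rewrite (big_cons _ _ i) P_lin IH usS// map_f// mem_enum.
exists [seq (p.1 *: star p.2, p.2) | p <- us]; split.
- by move=> _ /mapP[p hp ->] /=; split; [exact/DZ/Ds/usD|exact: usD].
- move=> x; rewrite big_map -PE; apply: eq_bigr => p _ /=.
  by rewrite -scalerAr tauZ.
- move=> x; rewrite big_map /= -[x in RHS]starK cexp_star -PE.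
  elim: us usR {usD usP usS PE} => [|p us IH] usR; first by rewrite !big_nil star0.
  rewrite !big_cons starD starZ IH => [|q hq]; last by apply: usR; rewrite inE hq orbT.
  congr (_ + _); rewrite rmorphM /= usR ?mem_head// -tau_star starM !starK scalerA.
  by rewrite mulrC.
Qed.

End ConditionalExpectation.

(** * Freeness with amalgamation *)

Section Alternating.
Context {R : realType} {M : tracialWType R}.
Variables (A B D : set M) (E : M -> M).
Hypothesis AP : unital_subalgebra A.
Hypothesis BP : unital_subalgebra B.
Hypothesis DP : unital_star_subalgebra D.
Hypothesis DA : D `<=` A.
Hypothesis DB : D `<=` B.
Hypothesis EP : conditional_expectation D E.
Implicit Types (a b d : M) (l p q : seq M) (c : bool).

Definition side c : set M := if c then A else B.

(** Lists replace indexed families so that words can be cut and extended. The empty list alternates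
    and has product 1, whence the recurring condition [l != [::]]. *)
Fixpoint alternates c l : Prop :=
  match l with
  | [::] => True
  | a :: l' => [/\ side c a, E a = 0 & alternates (~~ c) l']
  end.

Definition prodl l : M := \prod_(a <- l) a.

Lemma prodl_cons a l : prodl (a :: l) = a * prodl l.
Proof. by rewrite /prodl big_cons. Qed.

Lemma prodl_cat p q : prodl (p ++ q) = prodl p * prodl q.
Proof. by rewrite /prodl big_cat. Qed.

Lemma prodl_nil : prodl [::] = 1.
Proof. by rewrite /prodl big_nil. Qed.

Lemma prodl1 a : prodl [:: a] = a.
Proof. by rewrite prodl_cons prodl_nil mulr1. Qed.

Lemma prodl_rcons p a : prodl (rcons p a) = prodl p * a.
Proof. by rewrite -cats1 prodl_cat prodl1. Qed.

Lemma side_subalgebra c : unital_subalgebra (side c).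
Proof. by case: c. Qed.

Lemma side_D c d : D d -> side c d.
Proof. by case: c; [exact: DA|exact: DB]. Qed.

Lemma sideM c a b : side c a -> side c b -> side c (a * b).
Proof. by have [_ _ h] := subalgebraP (side_subalgebra c); exact: h. Qed.

Lemma sideB c a : side c a -> side c (a - E a).
Proof.
move=> ca; have [_ h _] := subalgebraP (side_subalgebra c).
rewrite addrC -scaleN1r; apply: h => //; apply: side_D; exact: (cexp_mem EP).
Qed.

Lemma alternates_cat c p q : alternates c (p ++ q) <->
  alternates c p /\ alternates (c (+) odd (size p)) q.
Proof.
elim: p c => [|a p IH] c /=; first by rewrite addbF; split=> // -[].
rewrite addbN -addNb; split=> [[h1 h2 /IH[h3 h4]]|[[h1 h2 h3] h4]]; first by [].
by split=> //; apply/IH.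
Qed.

Lemma alternates_nth c l : alternates c l <->
  forall j, (j < size l)%N -> side (c (+) odd j) (nth 0 l j) /\ E (nth 0 l j) = 0.
Proof.
elim: l c => [|a l IH] c /=; first by split.
split=> [[h1 h2 /IH h3] [|j] //= jl|h].
- by rewrite addbF.
- by rewrite addbN -addNb; exact: h3.
- have [] := h 0 isT; rewrite /= addbF => h1 h2; split=> //; apply/IH => j jl.
  by have := h j.+1 jl; rewrite /= addbN -addNb.
Qed.

Lemma free_subalgebrasP : free_subalgebras E A B <->
  forall c l, l != [::] -> alternates c l -> E (prodl l) = 0.
Proof.
split=> [h c [//|x l] _ hl|h s c a ha Ea].
  have /alternates_nth hl' := hl.
  rewrite /prodl (big_nth 0) big_mkord.
  by apply: (h (size l) c) => j; have [] := hl' j (ltn_ord j).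
pose l := [seq a j | j <- enum 'I_s.+1].
have sl : size l = s.+1 by rewrite size_map size_enum_ord.
have nl (j : 'I_s.+1) : nth 0 l j = a j.
  by rewrite (nth_map ord0) ?size_enum_ord// nth_ord_enum.
have <- : prodl l = \prod_j a j by rewrite /prodl /l big_map enumT [index_enum _]unlock.
apply: (h c l); first by rewrite -size_eq0 sl.
apply/alternates_nth => j; rewrite sl => js.
by rewrite (nl (Ordinal js)); split; [exact: (ha (Ordinal js))|].
Qed.

(** The first factor absorbs [d]: it stays on its side and stays centered, because [E] is a bimodule
    map. *)
Lemma alternates_scale c d l : D d -> l != [::] -> alternates c l ->
  exists l', [/\ size l' = size l, alternates c l' & prodl l' = d * prodl l].
Proof.
case: l => [//|a l] Dd _ [h1 h2 h3]; exists (d * a :: l); split=> //=.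
  split=> //; first by apply: sideM => //; exact: side_D.
  by rewrite (cexpMl DP EP)// h2 mulr0.
by rewrite !prodl_cons mulrA.
Qed.

Inductive alternating_sum : M -> Prop :=
| AltD d : D d -> alternating_sum d
| AltProd c l : alternates c l -> alternating_sum (prodl l)
| AltAdd u v : alternating_sum u -> alternating_sum v -> alternating_sum (u + v).

Lemma alternating_sumMD d c l : D d -> alternates c l -> alternating_sum (d * prodl l).
Proof.
move=> Dd; case: l => [|a l] hl; first by rewrite prodl_nil mulr1; exact: AltD.
by have [//|l' [_ hl' <-]] := alternates_scale Dd _ hl; exact: AltProd hl'.
Qed.

(** If the first factor of the word is on the side of [a], the two are merged and the product is
    recentered; otherwise [a] itself is centered and prepended. In both cases the removed
    expectation is a coefficient in [D] before a shorter alternating word or the word itself. *)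
Lemma alternating_sumM c a w : side c a -> alternating_sum w -> alternating_sum (a * w).
Proof.
have sum1 b : side c b -> alternating_sum b.
  move=> cb; rewrite -(subrK (E b) b); apply: AltAdd.
    rewrite -[b - _]prodl1; apply: (@AltProd c); split=> //; first exact: sideB.
    exact: (cexp_center DP EP).
  by apply: AltD; exact: (cexp_mem EP).
move=> ca; elim=> [d Dd|c' [|b l] hl|u v _ hu _ hv].
- by apply: sum1; apply: sideM => //; exact: side_D.
- by rewrite prodl_nil mulr1; exact: sum1.
- have [cc|cc] := eqVneq c c'.
    move: hl => [cb Eb hl]; subst c'; rewrite prodl_cons mulrA.
    have cab : side c (a * b) by exact: sideM.
    rewrite -(subrK (E (a * b)) (a * b)) mulrDl; apply: AltAdd.
      rewrite -prodl_cons; apply: (@AltProd c); split=> //; first exact: sideB.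
      exact: (cexp_center DP EP).
    by apply: alternating_sumMD hl; exact: (cexp_mem EP).
  rewrite -(subrK (E a) a) mulrDl; apply: AltAdd.
    rewrite -prodl_cons; apply: (@AltProd c); split; first exact: sideB.
      exact: (cexp_center DP EP).
    by rewrite (_ : ~~ c = c') //; move: cc; case: (c); case: (c').
  by apply: alternating_sumMD hl; exact: (cexp_mem EP).
- by rewrite mulrDr; exact: AltAdd.
Qed.

Lemma generated_alternating_sum S w : S `<=` A `|` B ->
  generated_algebra S w -> alternating_sum w.
Proof.
have [D1 _ _] := subalgebraP DP.1.
(* The factor 1 is generalised to any alternating sum [v], so that the elements [w] to be treated
   form an algebra. *)
move=> SAB hw; rewrite -(mulr1 w); move: (AltD D1); move: 1 => v hv.
move: w hw v hv.
apply: (@generated_algebra_sub _ _ _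
  [set w | forall v, alternating_sum v -> alternating_sum (w * v)]).
  have scale (z : R[i]) v : alternating_sum v -> alternating_sum (z *: v).
    rewrite -[v in z *: v]mul1r scalerAl; apply: (@alternating_sumM false).
    have [B1 Bl _] := subalgebraP BP; have B0 : B 0.
      by rewrite -(subrr (1 : M)) addrC -scaleN1r; exact: Bl.
    by rewrite /side -[z *: 1]addr0; exact: Bl.
  apply: subalgebraI => /=.
  - by move=> v; rewrite mul1r.
  - move=> z u v hu hv x hx; rewrite mulrDl -scalerAl; apply: AltAdd.
      exact/scale/hu.
    exact: hv.
  - by move=> u v hu hv x hx; rewrite -mulrA; apply/hu/hv.
move=> s /SAB[sA|sB] v; first exact: (@alternating_sumM true).
exact: (@alternating_sumM false).
Qed.

End Alternating.

(** Pythagoras: the second hypothesis makes [J1 - J2] orthogonal to [A], so [J2], which lies in the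
    closure of [A], is the projection of [J1]. *)
Lemma L2_norm_diff_cvg (R : realType) (M : tracialWType R) (S1 S2 A : set M)
    (J1 : L2 S1) (J2 : L2 S2) :
  (forall k, si_closure g2 A (J2 k)) ->
  (forall a, A a -> ltau J1 (star a) = ltau J2 (star a)) ->
  (fun k => g2 (J1 k - J2 k) (J1 k - J2 k)) @ \oo --> L2_norm J1 ^+ 2 - L2_norm J2 ^+ 2.
Proof.
move=> J2A h; have gP := @g2_semi_inner R M.
have c1 := @L2_si_cauchy _ _ _ J1; have c2 := @L2_si_cauchy _ _ _ J2.
have cd : si_cauchy g2 ((J1 : nat -> M) - (J2 : nat -> M)).
  by apply: si_cauchyD => //; exact: si_cauchyN.
have orth : (fun k => g2 (J1 k - J2 k) (J2 k)) @ \oo --> (0 : R).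
  apply: (g2_orth_cvg cd c2 J2A) => a Aa.
  have := @g2_cvg_ltau _ _ _ a cd; rewrite ltauDl//; last exact: si_cauchyN.
  by rewrite ltauNl// h// subrr.
rewrite -[L2_norm J2 ^+ 2]addr0 -[X in _ - (_ + X)](mulr0 2).
rewrite (_ : (fun k => _) = (fun k => g2 (J1 k) (J1 k) - (g2 (J2 k) (J2 k) +
    2 * g2 (J1 k - J2 k) (J2 k)))).
  apply: cvgB; first exact: L2_norm_cvg.
  apply: cvgD; first exact: L2_norm_cvg.
  by apply: cvgM; [exact: cvg_cst|exact: orth].
by apply: funext => k; rewrite (si_sqrB gP) (si_add gP _ _ (J2 k)) (si_opp gP); ring.
Qed.

Lemma g2_null_cvg (R : realType) (M : tracialWType R) (u : nat -> M) :
  (fun k => g2 (u k) (u k)) @ \oo --> (0 : R) -> g2_null u.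
Proof.
move=> h e e0; have /cvgrPdist_lt/(_ _ e0)[K _ hK] := h.
exists K => k Kk; have := hK k Kk; rewrite /= sub0r normrN ger0_norm//.
exact: g2_ge0.
Qed.

Lemma cvg_g2_null (R : realType) (M : tracialWType R) (u : nat -> M) :
  g2_null u -> (fun k => g2 (u k) (u k)) @ \oo --> (0 : R).
Proof.
move=> h; apply/cvgrPdist_lt => e e0; have [K hK] := h _ e0; exists K => // k Kk.
by rewrite /= sub0r normrN ger0_norm ?g2_ge0// hK.
Qed.

(** * Free Fisher information *)

Section Fisher.
Context {R : realType} {M : tracialWType R} {n : nat} (X : 'I_n -> M).
Hypothesis Xs : forall i, star (X i) = X i.
Implicit Types (K : set M).

Local Notation alg K := (generated_algebra (range X `|` K)).

Lemma alg_star K : unital_star_subalgebra K -> unital_star_subalgebra (alg K).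
Proof.
move=> KP; apply: generated_algebra_star => a [[i _ <-]|Ka].
  by left; rewrite Xs; exists i.
by right; exact: KP.2.
Qed.

Lemma conjugate_eq K K' (J : 'I_n -> L2 (range X `|` K))
    (J' : 'I_n -> L2 (range X `|` K')) i w :
  unital_star_subalgebra K -> unital_star_subalgebra K' -> K' `<=` K ->
  conjugate_variables J -> conjugate_variables J' ->
  alg K' w -> ltau (J i) w = ltau (J' i) w.
Proof.
move=> KP K'P K'K hJ hJ' /(free_diff_exists K'P.1)[T hT].
rewrite (conjugate_diff i K'P.1 hJ' hT).
exact: (conjugate_diff i KP.1 hJ (free_diff_mono K'K hT)).
Qed.

(** [free_fisher] picks an unspecified family of conjugate variables; this makes its value
    computable from any given one. *)
Lemma conjugate_norm_unique K (J J' : 'I_n -> L2 (range X `|` K)) i :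
  unital_star_subalgebra K -> conjugate_variables J -> conjugate_variables J' ->
  L2_norm (J i) ^+ 2 = L2_norm (J' i) ^+ 2.
Proof.
move=> KP hJ hJ'; have AP := alg_star KP.
have e a : alg K a -> ltau (J i) (star a) = ltau (J' i) (star a).
  by move=> Aa; apply: (conjugate_eq i KP KP) => //; exact: AP.2.
have h := L2_norm_diff_cvg (L2_dense Xs KP (J' i)) e.
have cJ := @L2_si_cauchy _ _ _ (J i); have cJ' := @L2_si_cauchy _ _ _ (J' i).
have nul : g2_null ((J i : nat -> M) - (J' i : nat -> M)).
  apply: (@g2_null_orth _ _ (alg K)).
  - by apply: si_cauchyD => //; exact: si_cauchyN.
  - move=> k; have [_ cl] := si_closure_subspace (@g2_semi_inner R M) (subalgebra_subspace AP.1).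
    rewrite fctE (_ : _ - _ = J i k + (-1)%:C *: J' i k); last first.
      by rewrite rmorphN rmorph1 scaleN1r.
    by apply: cl; exact: L2_dense.
  - move=> a Aa; rewrite ltauDl//; last exact: si_cauchyN.
    by rewrite ltauNl// e// subrr.
by apply/eqP; rewrite -subr_eq0; apply/eqP/(cvg_unique _ h)/cvg_g2_null.
Qed.

Lemma free_fisherE K (J : 'I_n -> L2 (range X `|` K)) :
  unital_star_subalgebra K -> conjugate_variables J ->
  free_fisher X K = (\sum_(i < n) L2_norm (J i) ^+ 2)%:E.
Proof.
move=> KP hJ; rewrite /free_fisher; case: pselect => [exJ|]; last by case; exists J.
congr (_%:E); apply: eq_bigr => i _; apply: conjugate_norm_unique => //.
by case: (cid exJ).
Qed.

Lemma free_fisher_fin K : (free_fisher X K < +oo)%E ->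
  exists J : 'I_n -> L2 (range X `|` K), conjugate_variables J.
Proof. by rewrite /free_fisher; case: pselect => // _; rewrite ltxx. Qed.

(* J' i is the orthogonal projection of J i onto the closure of alg K'. *)
Lemma conjugate_project K K' (J : 'I_n -> L2 (range X `|` K)) :
  unital_star_subalgebra K -> unital_star_subalgebra K' -> K' `<=` K ->
  conjugate_variables J ->
  exists J' : 'I_n -> L2 (range X `|` K'), conjugate_variables J'.
Proof.
move=> KP K'P K'K hJ; have AP := alg_star K'P; have gP := @g2_semi_inner R M.
have /choice[J' hJ'] i : exists J' : L2 (range X `|` K'),
    forall a, alg K' a -> ltau J' a = ltau (J i) a.
  have cJ := @L2_si_cauchy _ _ _ (J i).
  have [C [N [C0 hC]]] := si_cauchy_bounded cJ.
  pose f a := complex.Re (ltau (J i) (star a)).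
  have fb a : f a ^+ 2 <= C * g2 a a.
    have h := @g2_cvg_ltau _ _ _ a cJ.
    have h2 : (fun k => g2 (J i k) a ^+ 2) @ \oo --> f a ^+ 2.
      by under eq_fun do rewrite expr2; rewrite expr2; exact: (cvgM h h).
    rewrite -(cvg_lim _ h2)//; apply: limr_le; first by apply/cvg_ex; exists (f a ^+ 2).
    exists N => // k /= Nk; apply: le_trans (si_cauchy_schwarz gP _ _) _.
    by rewrite ler_wpM2r ?g2_ge0// hC.
  (* The minimising sequence already lies in [alg K'] and is Cauchy, so it serves directly as a
     vector of [L2]. *)
  have [|w [wA wc wf]] := riesz_approx gP (subalgebra_subspace AP.1) (ltW C0) _ (fun a _ => fb a).
    move=> r x y _ _; have rc : (r%:C)^* = r%:C :> R[i] by exact: conjc_real.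
    rewrite /f starD starZ rc ltauD//.
    rewrite (_ : ltau (J i) (r%:C *: star y) = r%:C * ltau (J i) (star y)).
      by rewrite raddfD /=; case: (ltau (J i) (star y)) => p q /=; rewrite mul0r subr0.
    apply: ltau_lim; under eq_fun do rewrite -scalerAr tauZ.
    by apply: cvgM; [exact: cvg_cst|exact: ltau_cvg].
  have wcau : si_cauchy g2 w.
    move=> e e0; have e4 : 0 < e / 4 by lra.
    have [L hL] := natSinv_lt e4; exists L => k l Lk Ll.
    apply: le_lt_trans (wc k l) _.
    move: (hL _ Lk) (hL _ Ll); move: (k.+1%:R^-1) (l.+1%:R^-1) => c d h1 h2; lra.
  have wcau' (e : R) : 0 < e -> exists L : nat, forall k l, (L <= k)%N -> (L <= l)%N ->
      norm2 (w k - w l) < e.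
    move=> e0; have [L hL] := wcau _ (exprn_gt0 2 e0).
    by exists L => k l Lk Ll; rewrite norm2_lt// hL.
  exists (L2Vector (fun k => generated_algebra_vN (wA k)) wcau') => a Aa.
  have re b : alg K' b -> complex.Re (ltau w (star b)) = f b.
    move=> Ab; apply: (cvg_unique _ (@g2_cvg_ltau _ _ _ b wcau)) => //.
    apply/cvgrPdist_lt => e e0.
    have b1 : 0 < g2 b b + 1 by rewrite ltr_wpDl// g2_ge0.
    have [L hL] := natSinv_lt (divr_gt0 (exprn_gt0 2 e0) b1); exists L => // k /= Lk.
    rewrite -ltr_sqr ?nnegrE ?(ltW e0)// real_normK ?num_real//.
    apply: le_lt_trans (wf k b Ab) _.
    have := hL k Lk; rewrite ltr_pdivlMr//; apply: le_lt_trans.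
    by rewrite ler_wpM2l ?invr_ge0//; lra.
  have [_ Al _] := subalgebraP AP.1.
  have A0 : alg K' 0 by have [] := subalgebra_subspace AP.1.
  have As : alg K' (star a) by exact: AP.2.
  have h1 := re _ As.
  (* Testing against ['i *: star a] recovers the imaginary part. *)
  have h2 : complex.Re (ltau w (star ('i *: star a))) = f ('i *: star a).
    by apply: re; rewrite -[_ *: _]addr0; exact: Al.
  rewrite /f starZ !starK in h1 h2.
  have li u : si_cauchy g2 u -> ltau u ('i^* *: a) = 'i^* * ltau u a.
    move=> cu; apply: ltau_lim; under eq_fun do rewrite -scalerAr tauZ.
    by apply: cvgM; [exact: cvg_cst|exact: ltau_cvg].
  rewrite !li// in h2; rewrite /=.
  move: h1 h2; case: (ltau w a) => p q; case: (ltau (J i) a) => p' q' /=.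
  rewrite !(mul0r, mulN1r, opprK, sub0r, add0r) => h1 h2.
  by rewrite h1 h2.
exists J' => i m b s K'b; rewrite -[LHS]/(ltau (J' i) (word X b s 0 m)) hJ'.
  by rewrite -[LHS]/(L2_tau (J i) (word X b s 0 m)) hJ// => k; exact: K'K.
have [G1 _ Gm] := subalgebraP AP.1.
have Gb k : alg K' (b k) by apply: sub_generated_algebra; right; exact: K'b.
apply: (Gm) => //; elim/big_ind : _ => [//|x y Gx Gy|k _]; apply: (Gm) => //.
by apply: sub_generated_algebra; left; exists (s k).
Qed.

End Fisher.

(** * Conjugate variables relative to B and to D *)

Section Main.
Context {R : realType} {M : tracialWType R} {n : nat} (X : 'I_n -> M).
Variables (B D : set M) (E : M -> M).
Hypothesis BP : unital_star_subalgebra B.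
Hypothesis Xs : forall i, star (X i) = X i.
Hypothesis DP : unital_star_subalgebra D.
Hypothesis DB : D `<=` B.
Hypothesis EP : conditional_expectation D E.
Hypothesis tauE : forall a, tau (E a) = tau a.
Hypothesis D_fin : finite_dimensional D.
Variables (JB : 'I_n -> L2 (range X `|` B)) (JD : 'I_n -> L2 (range X `|` D)).
Hypothesis hJB : conjugate_variables JB.
Hypothesis hJD : conjugate_variables JD.
Implicit Types (a b u v w : M) (l q : seq M) (c : bool).

Local Notation alg K := (generated_algebra (range X `|` K)).
Local Notation A := (alg D).
Local Notation alt := (alternates A B E).

Let AP : unital_star_subalgebra A. Proof. exact: alg_star. Qed.
Let DA : D `<=` A. Proof. by move=> d Dd; apply: sub_generated_algebra; right. Qed.
Let A1 : A 1. Proof. by have [] := subalgebraP AP.1. Qed.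
Let Am a b : A a -> A b -> A (a * b).
Proof. by have [_ _ h] := subalgebraP AP.1; exact: h. Qed.
Let B1 : B 1. Proof. by have [] := subalgebraP BP.1. Qed.

Let cJB i : si_cauchy g2 (JB i). Proof. exact: L2_si_cauchy. Qed.
Let cJD i : si_cauchy g2 (JD i). Proof. exact: L2_si_cauchy. Qed.

Let ltau_alg i a : A a -> ltau (JB i) a = ltau (JD i) a.
Proof. exact: conjugate_eq. Qed.

Let norm_diff_cvg i := L2_norm_diff_cvg (L2_dense Xs DP (JD i))
  (fun a Aa => ltau_alg i (AP.2 a Aa)).

(** * From freeness to equal Fisher informations *)

Section FreeImpliesEqual.
Hypothesis free : forall c l, l != [::] -> alt c l -> E (prodl l) = 0.

Let center a : E (a - E a) = 0. Proof. exact: (cexp_center DP EP). Qed.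

Let sideA a : A a -> A (a - E a).
Proof. exact: (@sideB _ _ A B D E AP.1 BP.1 DA DB EP true). Qed.

(** [a - E a] prolongs the alternating word, and [E a] can be pulled out of [E]; so [a] need not be
    centered. *)
Let free_left a l : A a -> l != [::] -> alt false l -> E (a * prodl l) = 0.
Proof.
move=> Aa l0 hl; rewrite -(subrK (E a) a) mulrDl (cexpD EP) -prodl_cons.
rewrite (free (c := true))//; last by split=> //; exact: sideA.
by rewrite add0r (cexpMl DP EP) ?(free l0 hl) ?mulr0//; exact: (cexp_mem EP).
Qed.

Let free_right a c p : A a -> p != [::] -> alt c p -> c (+) odd (size p) ->
  E (prodl p * a) = 0.
Proof.
move=> Aa p0 hp cp; rewrite -(subrK (E a) a) mulrDr (cexpD EP) -prodl_rcons.
rewrite (free (c := c)); [|by case: p {p0 hp cp}|].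
  by rewrite add0r (cexpMr DP EP) ?(free p0 hp) ?mul0r//; exact: (cexp_mem EP).
rewrite -cats1; apply/alternates_cat; split=> //; rewrite cp.
by split=> //; exact: sideA.
Qed.

(** The side condition excludes a single factor from [A]. Approximants of [JD i] lie in [A]; they
    precede a first factor from [B], or merge with a first factor from [A], and in both cases a
    nonempty alternating word starting in [B] follows. *)
Let ltau_alternating i c l : l != [::] -> alt c l ->
  (1 < size l)%N || ~~ c -> ltau (JD i) (prodl l) = 0.
Proof.
move=> l0 hl lc; have [a Aa nul] := approx_seq (L2_dense Xs DP (JD i)).
rewrite (ltau_eq (v := a) _ (cJD i))//; last exact: si_cauchy_null nul.
apply: ltau_lim; under eq_fun => k.
  rewrite -tauE.
  have -> : E (a k * prodl l) = 0.
    case: c hl lc => [|hl _]; last exact: free_left.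
    case: l l0 => [//|b [//|b' l]] _ [Ab _ hl] _.
    by rewrite prodl_cons mulrA; apply: free_left => //; exact: Am.
  rewrite tau0; over.
exact: cvg_cst.
Qed.

(** Only factors from [A] are differentiated. Splitting such a factor into x (x) y, with [p] before
    it and [q] after it, gives [tau (p x) * tau (y q)]: the second trace vanishes if [q] is
    nonempty, the first if [p] is. The side condition excludes that both are empty. *)
Let diff_alternating c p q : alt c (p ++ q) -> (1 < size (p ++ q))%N || ~~ c ->
  exists2 T, free_diff X B (prodl q) T &
    {in T, forall t, tau (prodl p * t.1.2) * tau t.2 = 0}.
Proof.
elim: q p => [|a q IH] p hpq hc.
  by exists [::] => //; rewrite prodl_nil; exact: DiffConst.
have [||U hU zU] := IH (rcons p a); rewrite ?cat_rcons//.
have /alternates_cat[hp /= [sa Ea hq]] := hpq.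
case sE : (c (+) odd (size p)) sa hq => sa hq.
  have [T hT] := free_diff_exists DP.1 sa.
  have hTU := DiffMul (free_diff_mono DB hT) hU.
  rewrite -prodl_cons in hTU; eexists; first exact: hTU.
  move=> t; rewrite mem_cat => /orP[] /mapP[[[i x] y] ht ->] /=; last first.
    by rewrite mulrA -prodl_rcons; exact: (zU _ ht).
  have [/= Ax Ay] := free_diff_mem DP.1 hT ht.
  have [q0|q0] := eqVneq q [::]; last first.
    by rewrite -(tauE (y * _)) (free_left Ay q0 hq) tau0 mulr0.
  have [p0|p0] := eqVneq p [::]; last first.
    by rewrite -(tauE (prodl p * _)) (free_right Ax p0 hp sE) tau0 mul0r.
  by move: hc sE; rewrite q0 p0 /= addbF => /negPf ->.
have hTU := DiffMul (DiffConst X sa) hU; rewrite -prodl_cons /= in hTU.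
eexists; first exact: hTU.
move=> _ /mapP[[[i x] y] ht ->] /=.
by rewrite mulrA -prodl_rcons; exact: (zU _ ht).
Qed.

Let ltau_eq_free i w : alg B w -> ltau (JB i) w = ltau (JD i) w.
Proof.
move=> hw.
have : alternating_sum A B D E w.
  apply: (@generated_alternating_sum _ _ A B D E AP.1 BP.1 DP DA DB EP (range X `|` B)) => //.
  by move=> a [Xa|Ba]; [left; apply: sub_generated_algebra; left|right].
elim=> [d Dd|c l hl|u v _ hu _ hv]; first by apply: ltau_alg; exact: DA.
  case: (boolP ((1 < size l)%N || ~~ c)) => hc; last first.
    apply: ltau_alg; move: hl hc.
    case: l => [|a [|b l]] //=; first by rewrite prodl_nil.
    by case: c => //= -[Aa _ _] _; rewrite prodl1.
  have [->|l0] := eqVneq l [::]; first by rewrite prodl_nil; exact: ltau_alg.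
  rewrite (ltau_alternating _ l0 hl hc).
  have [T hT zT] := @diff_alternating c [::] l hl hc.
  rewrite (conjugate_diff i BP.1 hJB hT) /diff_tau big1_seq// => t /andP[_ tT].
  by have := zT _ tT; rewrite prodl_nil mul1r => ->; rewrite mulr0.
by rewrite !ltauD// hu hv.
Qed.

Lemma free_norm_eq i : L2_norm (JB i) ^+ 2 = L2_norm (JD i) ^+ 2.
Proof.
have ABP := alg_star Xs BP.
have nul : g2_null ((JB i : nat -> M) - (JD i : nat -> M)).
  apply: (@g2_null_orth _ _ (alg B)).
  - by apply: si_cauchyD => //; exact: si_cauchyN.
  - move=> k; have [_ cl] := si_closure_subspace (@g2_semi_inner R M) (subalgebra_subspace ABP.1).
    rewrite fctE (_ : _ - _ = JB i k + (-1)%:C *: JD i k); last first.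
      by rewrite rmorphN rmorph1 scaleN1r.
    apply: cl; first exact: L2_dense.
    move=> e e0; have [a Aa ha] := L2_dense Xs DP (JD i) k e0; exists a => //.
    apply: generated_algebra_sub Aa => [|b [Xb|Db]]; first exact: ABP.1.
      by apply: sub_generated_algebra; left.
    by apply: sub_generated_algebra; right; exact: DB.
  - move=> a Aa; rewrite ltauDl//; last exact: si_cauchyN.
    by rewrite ltauNl// ltau_eq_free ?subrr//; exact: ABP.2.
apply/eqP; rewrite -subr_eq0; apply/eqP/(cvg_unique _ (@norm_diff_cvg i)) => //.
exact: (cvg_g2_null nul).
Qed.

End FreeImpliesEqual.

(** * From equal Fisher informations to freeness *)

Section EqualImpliesFree.
Hypothesis sum_eq :
  \sum_(i < n) L2_norm (JB i) ^+ 2 = \sum_(i < n) L2_norm (JD i) ^+ 2.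

(** The hypothesis concerns the sums only, but each difference of squared norms is a limit of
    squared distances, hence nonnegative; so every one vanishes. *)
Let norm_diff_null i : g2_null ((JB i : nat -> M) - (JD i : nat -> M)).
Proof.
apply: g2_null_cvg.
have ge0 j : 0 <= L2_norm (JB j) ^+ 2 - L2_norm (JD j) ^+ 2.
  rewrite -(cvg_lim _ (@norm_diff_cvg j))//; apply: limr_ge.
    by apply/cvg_ex; eexists; exact: norm_diff_cvg.
  by near=> k; exact: g2_ge0.
have /psumr_eq0P h : \sum_(j < n) (L2_norm (JB j) ^+ 2 - L2_norm (JD j) ^+ 2) = 0.
  by rewrite sumrB sum_eq subrr.
rewrite -(h (fun j _ => ge0 j) i isT).
exact: norm_diff_cvg.
Unshelve. all: by end_near. Qed.

(* The value of (tau (x) tau) on u # delta w # v, where delta is the derivation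
   vanishing on B with delta x = [x, Omega] for x in X, Omega = sum e (x) f being
   the D-central element of D (x) D given by dual bases; it is a D-valued
   version of Voiculescu's liberation gradient. *)
Definition liberation u (T : seq ('I_n * M * M)) v : R[i] :=
  \sum_(t <- T) (tau (u * t.1.2 * X t.1.1 * E (t.2 * v)) -
                 tau (E (u * t.1.2) * X t.1.1 * (t.2 * v))).

(** The Leibniz rule of the derivation. *)
Let liberation_catM u T v w U :
  liberation u ([seq (t.1.1, t.1.2, t.2 * v) | t <- T] ++
                [seq (t.1.1, w * t.1.2, t.2) | t <- U]) 1 =
  liberation u T v + liberation (u * w) U 1.
Proof.
rewrite /liberation big_cat !big_map /=; congr (_ + _); apply: eq_bigr => t _.
  by rewrite mulr1.
by rewrite !mulrA.
Qed.

(* On the algebra of X and D the derivation is the commutator with Omega. *)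
Let liberation_alg a T : free_diff X D a T -> forall u v,
  liberation u T v = tau (E (u * a) * E v) - tau (E u * E (a * v)).
Proof.
elim=> [d Dd|j|a1 T1 a2 T2 _ h1 _ h2|a1 T1 a2 T2 _ h1 _ h2] u v.
- by rewrite /liberation big_nil (cexpMr DP EP)// (cexpMl DP EP)// mulrA subrr.
- rewrite /liberation big_seq1 /= !mulr1 mul1r -(mulrA (E u)).
  rewrite (tau_cexpMl DP EP tauE u (X j * v)).
  by rewrite (tau_cexpMr DP EP tauE (u * X j) v).
- rewrite /liberation big_cat /= -!/(liberation _ _ _) h1 h2.
  rewrite mulrDr mulrDl !(cexpD EP) mulrDl mulrDr !tauD; ring.
- rewrite (_ : liberation u _ v = liberation u T1 (a2 * v) + liberation (u * a1) T2 v).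
    by rewrite h1 h2 !mulrA; ring.
  rewrite /liberation big_cat !big_map /=; congr (_ + _); apply: eq_bigr => t _.
    by rewrite -(mulrA t.2).
  by rewrite !mulrA.
Qed.

Let bs_spec := dual_basis_exists DP EP tauE D_fin.
Let bs : seq (M * M) := sval (cid bs_spec).
Let bsD : {in bs, forall p, D p.1 /\ D p.2}.
Proof. by rewrite /bs; case: cid => /= ? []. Qed.
Let bsl x : \sum_(p <- bs) tau (x * p.1) *: p.2 = E x.
Proof. by rewrite /bs; case: cid => /= ? []. Qed.
Let bsr x : \sum_(p <- bs) tau (p.2 * x) *: p.1 = E x.
Proof. by rewrite /bs; case: cid => /= ? []. Qed.

(** [tau (Lambda w)] for the [Lambda] of the overview, rotated by traciality so that [JB i] stands
    first; [p] is a pair [(e_k, f_k)]. *)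
Let G w : R[i] := \sum_(i < n) \sum_(p <- bs)
  (ltau (JB i) (X i * (p.1 * (w * p.2))) - ltau (JB i) (p.1 * (w * (p.2 * X i)))).

(** The conjugate relations are applied to the words [X_i e w f] and [e w f X_i], and the sum over
    the dual bases turns products of traces into [E]. *)
Let G_liberation w T : free_diff X B w T -> G w = liberation 1 T 1.
Proof.
move=> hT.
pose h (t : 'I_n * M * M) (p : M * M) :=
  tau (X t.1.1 * (p.1 * t.1.2)) * tau (t.2 * p.2) -
  tau (p.1 * t.1.2) * tau (t.2 * (p.2 * X t.1.1)).
have step i p : p \in bs ->
    ltau (JB i) (X i * (p.1 * (w * p.2))) - ltau (JB i) (p.1 * (w * (p.2 * X i))) =
    \sum_(t <- T) (i == t.1.1)%:R * h t p.
  move=> /bsD[/DB B1' /DB B2'].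
  have d1 := DiffMul (DiffVar X B i) (DiffMul (DiffConst X B1') (DiffMul hT (DiffConst X B2'))).
  have d2 := DiffMul (DiffConst X B1') (DiffMul hT (DiffMul (DiffConst X B2') (DiffVar X B i))).
  rewrite (conjugate_diff i BP.1 hJB d1) (conjugate_diff i BP.1 hJB d2).
  rewrite /diff_tau /= !cats0 !map_cat !big_cat !big_map !big_cons !big_nil /= eqxx.
  rewrite !mul1r !mulr1 !addr0 tau1 !mul1r mulr1.
  (* Differentiating the outer [X i] gives [tau (e w f)] in both words; these terms cancel, and only
     the derivatives of [w] remain. *)
  rewrite !big_map /= [X in X - _]addrC [X in _ - X]addrC addrKA -sumrB.

  apply: eq_bigr => t _; rewrite /h -mulrBr.
  by case: eqP => [->//|_]; rewrite !mul0r.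
rewrite /G; under eq_bigr do rewrite (eq_big_seq _ (step _)).
under eq_bigr do rewrite exchange_big /=.
rewrite exchange_big /= /liberation; apply: eq_bigr => t _.
under eq_bigr do rewrite -mulr_sumr.
rewrite -mulr_suml (bigD1 t.1.1)//= eqxx big1 ?addr0; last by move=> i /negPf ->.
rewrite mul1r mulr1 mul1r -bsr -[E t.1.2]bsl sumrB; congr (_ - _).
  rewrite mulr_sumr tau_sum; apply: eq_bigr => p _.
  rewrite -scalerAr tauZ [LHS]mulrC; congr (_ * _); first exact: tau_trace.
  by rewrite mulrA tau_trace mulrA.
rewrite !mulr_suml tau_sum; apply: eq_bigr => p _.
rewrite -!scalerAl tauZ; congr (_ * _); exact: tau_trace.
Qed.

Let G_alg w : A w -> G w = 0.
Proof.
move=> /(free_diff_exists DP.1)[T hT]; rewrite (G_liberation (free_diff_mono DB hT)).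
by rewrite (liberation_alg hT) mul1r mulr1 (cexp1 EP) mulr1 mul1r subrr.
Qed.

Let G_eq0 w : G w = 0.
Proof.
have /choice[a ha] i : exists a : nat -> M, (forall k, A (a k)) /\
    g2_null ((JD i : nat -> M) - a).
  by have [a Aa h] := approx_seq (L2_dense Xs DP (JD i)); exists a.
have ca i : si_cauchy g2 (a i) by apply: si_cauchy_null (cJD i) _; case: (ha i).
have ae i v : ltau (JB i) v = ltau (a i) v.
  rewrite (ltau_eq _ (cJB i) (cJD i) (@norm_diff_null i)).
  by apply: ltau_eq => //; case: (ha i).
(* [lam] represents [Lambda] by elements of [A], which is possible because [JB i] has been
   identified with [JD i]. *)
pose lam : nat -> M := \sum_(i < n) \sum_(p <- bs)
  ((fun k => p.2 * a i k * (X i * p.1)) + - (fun k => p.2 * X i * a i k * p.1)).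
have clam1 i p : si_cauchy g2 ((fun k => p.2 * a i k * (X i * p.1)) +
    - (fun k => p.2 * X i * a i k * p.1)).
  by apply: si_cauchyD; [|apply: si_cauchyN]; exact: si_cauchyM.
have clam : si_cauchy g2 lam.
  by apply: si_cauchy_sum => i; exact: si_cauchy_sum.
have Glam v : ltau lam v = G v.
  rewrite /lam ltau_suml; last by move=> i; exact: si_cauchy_sum.
  apply: eq_bigr => i _; rewrite ltau_suml//; apply: eq_bigr => p _.
  rewrite ltauDl ?ltauNl ?ltauM ?ae ?mulrA//; try exact: si_cauchyM.
  by apply: si_cauchyN; exact: si_cauchyM.
rewrite -Glam; apply: ltau_null; apply: (@g2_null_orth _ _ A) => //.
  move=> k; apply: (si_closure_sub (@g2_semi_inner R M)).
  have [A0 Al] := subalgebra_subspace AP.1.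
  have AD u v : A u -> A v -> A (u + v).
    by move=> Au Av; have := Al 1 u v Au Av; rewrite rmorph1 scale1r.
  have AN v : A v -> A (- v).
    by move=> Av; have := Al (-1) 0 v A0 Av; rewrite rmorphN rmorph1 scaleN1r add0r.
  have AX i : A (X i) by apply: sub_generated_algebra; left; exists i.
  have sumk (I : eqType) (s : seq I) (F : I -> nat -> M) :
      {in s, forall i, A (F i k)} -> A ((\sum_(i <- s) F i) k).
    elim: s => [_|i s IH h]; first by rewrite big_nil.
    rewrite big_cons; apply: AD; first by apply: h; rewrite mem_head.
    by apply: IH => j js; apply: h; rewrite inE js orbT.
  apply: (sumk) => i _; apply: (sumk) => p /bsD[/DA Ap1 /DA Ap2].
  have Aa : A (a i k) by case: (ha i).
  by apply: AD; [|apply: AN]; do !apply: Am.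
by move=> v Av; rewrite Glam G_alg//; exact: AP.2.
Qed.

(** At a factor [a] from [A] after a prefix [p] and before a suffix [q'], the derivation gives [tau
    (E (p a) * E q') - tau (E p * E (a q'))]. As [E] kills nonempty proper prefixes, only the first
    term with empty [q'] survives, and it is the trace of the whole word. The parity condition says
    that the last factor lies in [A]. *)
Let liberation_alternating c p q : p != [::] -> alt c q ->
  (forall p1 q1, p1 != [::] -> q1 != [::] -> p ++ q = p1 ++ q1 -> E (prodl p1) = 0) ->
  exists2 T, free_diff X B (prodl q) T &
    liberation (prodl p) T 1 =
    if (q != [::]) && (c (+) ~~ odd (size q)) then tau (prodl (p ++ q)) else 0.
Proof.
elim: q c p => [|a q IH] c p p0 hq hE.
  exists [::]; last by rewrite /liberation big_nil.
  by rewrite prodl_nil; exact: DiffConst.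
move: hq => [sa Ea hq].
have [||U hU lU] := IH (~~ c) (rcons p a) _ hq; first by case: (p).
  by move=> p1 q1 h1 h2; rewrite cat_rcons; exact: hE.
have Ep : E (prodl p) = 0 by exact: (hE p (a :: q)).
have [T hT lT] : exists2 T, free_diff X B a T &
    liberation (prodl p) T (prodl q) = if c && (q == [::]) then tau (prodl (p ++ a :: q)) else 0.
  case: c sa hq {lU} => sa hq.
    have [T hT] := free_diff_exists DP.1 sa.
    exists T; first exact: free_diff_mono hT.
    rewrite (liberation_alg hT) Ep mul0r tau0 subr0 -prodl_rcons /=.
    case: eqVneq => [->|q0].
      by rewrite prodl_nil (cexp1 EP) mulr1 tauE cats1.
    by rewrite (hE (rcons p a) q)// ?mul0r ?tau0 ?cat_rcons//; case: (p).
  exists [::]; first exact: DiffConst.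
  by rewrite /liberation big_nil.
have := DiffMul hT hU; rewrite -prodl_cons => hTU; eexists; first exact: hTU.
rewrite liberation_catM lT -prodl_rcons lU cat_rcons /=.
case: (eqVneq q [::]) => [->|q0] /=; first by case: (c); rewrite /= addr0.
by rewrite andbF add0r; case: (c); case: (odd _).
Qed.

(** A first factor from [A] contributes [- tau w] to the derivation, and a last factor from [A]
    contributes [tau w]. Exactly one of them lies in [A] when the length is even; for odd length
    both or neither do, and the derivation gives no information. *)
Let tau_alternating c l : l != [::] -> alt c l ->
  (forall c' l', (size l' < size l)%N -> l' != [::] -> alt c' l' -> E (prodl l') = 0) ->
  tau (prodl l) = 0.
Proof.
case: l => [//|a q] _ [sa Ea hq] IH.
have [q0|q0] := eqVneq q [::]; first by rewrite q0 prodl1 -tauE Ea tau0.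
case sq : (odd (size q)); last first.
  (* Odd length: by traciality the last factor merges with the first. *)
  case/lastP: q q0 sq hq IH => [//|m z] _; rewrite size_rcons /= => /negbFE sm.
  rewrite -cats1 => /alternates_cat[hm] /=; rewrite sm addbT negbK => -[sz Ez _] IH.
  have m0 : m != [::] by case: (m) sm.
  have saz : side A B c (z * a) by exact: (sideM AP.1 BP.1).
  have -> : prodl (a :: m ++ [:: z]) = a * prodl m * z.
    by rewrite prodl_cons prodl_cat prodl1 mulrA.
  rewrite tau_trace mulrA.
  (* The merged factor is recentered; what remains is one shorter alternating word and another with
     a coefficient in [D]. *)
  have -> : z * a * prodl m = prodl (z * a - E (z * a) :: m) + E (z * a) * prodl m.
    by rewrite prodl_cons -mulrDl subrK.
  rewrite tauD -(tauE (prodl _)) -(tauE (_ * prodl m)).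
  rewrite (IH c); [|by rewrite /= size_cat addn1|by []|]; last first.
    by split=> //; [exact: (sideB AP.1 BP.1 DA DB EP)|exact: (cexp_center DP EP)].
  rewrite (cexpMl DP EP); last exact: (cexp_mem EP).
  by rewrite (IH (~~ c) m)// ?mulr0 ?tau0 ?addr0//= size_cat addn1 ltnS leqnSn.
have hE p1 q1 : p1 != [::] -> q1 != [::] -> a :: q = p1 ++ q1 -> E (prodl p1) = 0.
  move=> p0 q10 e; apply: (IH c) => //.
    by rewrite e size_cat -[X in (X < _)%N]addn0 ltn_add2l lt0n size_eq0.
  have : alt c (a :: q) by [].
  by rewrite e => /alternates_cat[].
have [U hU lU] := @liberation_alternating (~~ c) [:: a] q isT hq hE.
have [T hT lT] : exists2 T, free_diff X B a T &
    liberation 1 T (prodl q) = if c then - tau (prodl (a :: q)) else 0.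
  case: c sa {hq IH hE lU} => sa.
    have [T hT] := free_diff_exists DP.1 sa.
    exists T; first exact: free_diff_mono hT.
    by rewrite (liberation_alg hT) mul1r Ea mul0r tau0 sub0r (cexp1 EP) mul1r tauE prodl_cons.
  exists [::]; first exact: DiffConst.
  by rewrite /liberation big_nil.
have := G_liberation (DiffMul hT hU); rewrite G_eq0 liberation_catM lT.
rewrite mul1r -[a in liberation a]prodl1 lU q0 sq /= addbF.
case: (c) => /=; first by rewrite addr0 => /esym/eqP; rewrite oppr_eq0 => /eqP.
by rewrite add0r.
Qed.

(** [E w] vanishes once [tau (d * w) = 0] for all [d] in [D]. The word absorbs [d] without changing
    its length, so the induction on a bound for the length applies. *)
Lemma norm_eq_free c l : l != [::] -> alt c l -> E (prodl l) = 0.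
Proof.
move: {2}(size l) (leqnn (size l)) => N; elim: N c l => [|N IH] c l.
  by rewrite leqn0 size_eq0 => /eqP ->.
move=> lN l0 hl; apply: (cexp_eq0 DP EP tauE) => d Dd.
have [l' [sl hl' <-]] := alternates_scale AP.1 BP.1 DP DA DB EP Dd l0 hl.
apply: (tau_alternating (c := c)) => //; first by rewrite -size_eq0 sl size_eq0.
move=> c' l'' h; apply: IH; rewrite -ltnS; apply: leq_trans h _.
by rewrite sl.
Qed.

End EqualImpliesFree.
End Main.

Theorem theorem6p2 (R : realType) (M : tracialWType R) (n : nat)
    (X : 'I_n -> M) (B D : set M) (E : M -> M) :
  unital_star_subalgebra B ->
  (forall i, star (X i) = X i) ->
  (free_fisher X B < +oo)%E ->
  unital_star_subalgebra D ->
  D `<=` B ->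
  conditional_expectation D E ->
  (forall a, tau (E a) = tau a) ->
  finite_dimensional D ->
  (free_fisher X D = free_fisher X B <-> free_over D E (range X) B).
Proof.
move=> BP Xs fB DP DB EP tauE D_fin.
have [JB hJB] := free_fisher_fin fB.
have [JD hJD] := conjugate_project Xs BP DP DB hJB.
rewrite (free_fisherE Xs BP hJB) (free_fisherE Xs DP hJD).
split=> [[e]|free].
  apply/free_subalgebrasP.
  exact: (norm_eq_free BP Xs DP DB EP tauE D_fin hJB hJD (esym e)).
congr (_%:E); apply: eq_bigr => i _; apply/esym.
have /free_subalgebrasP free' := free.
exact: (free_norm_eq BP Xs DP DB EP tauE hJB hJD free').
Qed.
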